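(* For every graph $H$: (i) $\mathcal{I}_H$ has bounded underlying treewidth if and only if $H$ is a star-forest; (ii) if $H$ is a star-forest, then $\mathcal{I}_H$ has underlying treewidth at most $2$; (iii) $\mathcal{I}_H$ has underlying treewidth at most $1$ if and only if $H$ is a star or each component of $H$ is a path on at most three vertices; (iv) $\mathcal{I}_H$ has underlying treewidth $0$ if and only if $H$ is a path on at most three vertices or $E(H)=\emptyset$.
   Context: Graphs are finite, simple and undirected; $\mathrm{tw}$ denotes treewidth. $\mathcal{I}_H$ is the class of graphs having no induced subgraph isomorphic to $H$. A star-forest is a forest each of whose components is a star $K_{1,s}$ ($s\ge0$). For graphs $G,J$, a $J$-partition of $G$ is a partition $(V_x : x\in V(J))$ of $V(G)$ such that for every edge $vw$ of $G$ with $v\in V_x$, $w\in V_y$, either $x=y$ or $xy\in E(J)$; its width is $\max_x|V_x|$. $\mathrm{tpw}_c(G)$ is the minimum width of a $J$-partition of $G$ over all graphs $J$ with $\mathrm{tw}(J)\le c$. The underlying treewidth of a graph class $\mathcal{G}$ is the minimum $c\in\mathbb{N}_0$ for which there is a function $f$ with $\mathrm{tpw}_c(G)\le f(\mathrm{tw}(G))$ for all $G\in\mathcal{G}$; it is bounded if such a $c$ exists. *)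

(* Defs.v *)
From mathcomp Require Import all_boot.
From mathcomp Require Import boolp.

Set Implicit Arguments.
Unset Strict Implicit.
Unset Printing Implicit Defensive.

Record sgraph := SGraph {
  gV : finType;
  gadj : rel gV;
  gsym : symmetric gadj;
  girr : irreflexive gadj }.
Arguments gadj : clear implicits.

Definition acyclic (T : sgraph) : Prop :=
  forall (x : gV T) (s : seq (gV T)), uniq (x :: s) -> 2 <= size s ->
    path (gadj T) x s -> ~~ gadj T (last x s) x.

Definition is_tree (T : sgraph) : Prop :=
  0 < #|gV T| /\ (forall x y : gV T, connect (gadj T) x y) /\ acyclic T.

Definition tree_decomp (G T : sgraph) (B : gV T -> {set gV G}) : Prop :=
  [/\ is_tree T,
      (forall v : gV G, exists t, v \in B t),
      (forall v w : gV G, gadj G v w -> exists t, (v \in B t) && (w \in B t)) &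
      (forall (v : gV G) (t1 t2 : gV T), v \in B t1 -> v \in B t2 ->
         connect [rel a b | [&& gadj T a b, v \in B a & v \in B b]] t1 t2)].

Definition tw_le (G : sgraph) (k : nat) : Prop :=
  exists (T : sgraph) (B : gV T -> {set gV G}), tree_decomp B /\ forall t, #|B t| <= k.+1.

Definition unit_sgraph : sgraph :=
  @SGraph unit (fun _ _ => false) (fun _ _ => erefl) (fun _ => erefl).

Lemma tw_exists (G : sgraph) : exists k, `[< tw_le G k >].
Proof.
exists #|gV G|; apply/asboolP; exists unit_sgraph, (fun _ => [set: gV G]); split.
- split.
  + split; first by rewrite card_unit.
    split; first by case; case; exact: connect0.
    by move=> x s _ _ _.
  + by move=> v; exists tt; rewrite inE.
  + by move=> v w _; exists tt; rewrite !inE.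
  + by move=> v [] [] _ _; exact: connect0.
- by move=> _; rewrite cardsT leqW.
Qed.

Definition tw (G : sgraph) : nat := ex_minn (tw_exists G).

(* tpw_c(G) <= w : there is a graph J with tw(J) <= c and a J-partition of G of
   width <= w.  A J-partition (V_x : x in V(J)) is encoded by the map p sending
   each vertex of G to the index of its part (V_x = p^-1(x); parts may be empty). *)
Definition tpw_le (c : nat) (G : sgraph) (w : nat) : Prop :=
  exists (J : sgraph) (p : gV G -> gV J),
    [/\ tw J <= c,
        (forall v u : gV G, gadj G v u -> p v = p u \/ gadj J (p v) (p u)) &
        (forall x : gV J, #|[set v | p v == x]| <= w)].

Definition gclass := sgraph -> Prop.

Definition utw_witness (C : gclass) (c : nat) : Prop :=
  exists f : nat -> nat, forall G : sgraph, C G -> tpw_le c G (f (tw G)).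

Definition utw_le (C : gclass) (c : nat) : Prop :=
  exists c', c' <= c /\ utw_witness C c'.

Definition bounded_utw (C : gclass) : Prop := exists c, utw_witness C c.

Definition induced_sub (H G : sgraph) : Prop :=
  exists f : gV H -> gV G, injective f /\ forall x y : gV H, gadj G (f x) (f y) = gadj H x y.

Definition I_ (H : sgraph) : gclass := fun G => ~ induced_sub H G.

Definition component (H : sgraph) (x : gV H) : {set gV H} := [set y | connect (gadj H) x y].

Definition star_on (H : sgraph) (C : {set gV H}) : Prop :=
  exists2 c, c \in C & forall y z, y \in C -> z \in C ->
    (gadj H y z <-> ((y == c) && (z != c)) || ((z == c) && (y != c))).

Definition is_star (H : sgraph) : Prop := star_on [set: gV H].

Definition star_forest (H : sgraph) : Prop := forall x : gV H, star_on (component x).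

Definition path_on (H : sgraph) (C : {set gV H}) : Prop :=
  exists s : seq (gV H), [/\ 0 < size s, uniq s, [set y in s] = C &
    forall y z, y \in C -> z \in C ->
      (gadj H y z <-> exists i, i.+1 < size s /\
         ((nth y s i = y /\ nth y s i.+1 = z) \/ (nth y s i = z /\ nth y s i.+1 = y)))].

Definition no_edges (H : sgraph) : Prop := forall x y : gV H, ~~ gadj H x y.

(* Main.v *)
(* Upper bounds.  In a tree decomposition, subtrees satisfy an Erdos-Posa
   property: a graph of treewidth k has either many pairwise anticomplete induced
   s-leaf stars, which together contain the star forest H, or a set X of bounded
   size meeting all of them.  Since treewidth-k graphs are k-degenerate, G - X
   then has bounded degree, hence a tree-partition of bounded width (Ding and
   Oporowski); X becomes one further part, adjacent to all others.  If the stars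
   have at most two leaves, then G - X is a disjoint union of cliques and the
   indexing graph is a star.

   Lower bounds.  In the closure of a deep and wide tree one can descend through
   children lying in ever new parts, so the indexing graph contains a large clique;
   keeping only the edges between levels of different parity yields a large
   complete bipartite graph instead.  The first graph has no induced path or cycle
   on four vertices, the second no triangle.  Fans have no induced K_{1,3} + K_1
   and force a triangle in the indexing graph; stars and paths force an edge. *)

Require Import Defs.
From mathcomp Require Import all_boot.
From mathcomp Require Import boolp zify.

Set Implicit Arguments.
Unset Strict Implicit.
Unset Printing Implicit Defensive.

(** * Rooted tree decompositions *)

(** The tree-partition comes from a recursion on a vertex set [C] with a small set [S] forced into
    the root part. An lca-closed set of nodes containing the tops of [S] yields a separator [Z] of
    [C] containing [S], and every component of [C - Z] has its [Z]-neighbours in just two bags. With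
    degrees at most d, at most 2(k+1)d vertices of that component touch [Z]; these form the next
    [S], so its size does not grow with the depth of the recursion. This is where bounded degree is
    indispensable, and why the set [X] has to be removed beforehand. In the lower bounds, a witness
    [f] matters only at finitely many treewidths, so one width w serves all test graphs of treewidth
    at most m; the branching or length of the test graph is chosen after w. Dense subgraphs of the
    indexing graph are excluded through degeneracy. *)

Lemma tw_le_mono (G : sgraph) (k m : nat) : k <= m -> tw_le G k -> tw_le G m.
Proof.
move=> lekm [T [B [tdB wB]]]; exists T, B; split=> // t.
exact: leq_trans (wB t) _.
Qed.

Lemma tw_leP (G : sgraph) (k : nat) : tw G <= k <-> tw_le G k.
Proof.
rewrite /tw; case: ex_minnP => m /asboolP twm minm; split=> [lemk|twk].
  exact: tw_le_mono twm.
by apply: minm; apply/asboolP.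
Qed.

(* A tree decomposition with the tree given by a parent map: [h] strictly
   decreases towards the root [r], and the bags containing [v] are those of a
   subtree with highest node [top v]. *)
Record rooted_td (G : sgraph) (T : finType) (r : T) (par : T -> T) (h : T -> nat)
    (top : gV G -> T) (B : T -> {set gV G}) (k : nat) : Prop := RootedTD {
  rtd_root : par r = r;
  rtd_desc : forall t, t != r -> h (par t) < h t;
  rtd_top : forall v, v \in B (top v);
  rtd_climb : forall v t, v \in B t -> t != top v -> t != r /\ v \in B (par t);
  rtd_edge : forall v w, gadj G v w -> exists t, (v \in B t) && (w \in B t);
  rtd_width : forall t, #|B t| <= k.+1 }.

(** On a cycle, take a vertex of maximal [h]: each of its two cycle neighbours must be its parent,
    yet they are distinct. *)
Lemma acyclic_parent (T : sgraph) (r : gV T) (par : gV T -> gV T) (h : gV T -> nat) :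
  par r = r -> (forall t, t != r -> h (par t) < h t) ->
  (forall a b, gadj T a b -> par a = b \/ par b = a) -> acyclic T.
Proof.
move=> par_r desc adjP x s Us ss ps; apply/negP=> adj_last.
have cyc : cycle (gadj T) (x :: s) by rewrite /= rcons_path ps adj_last.
have [y ys ymax] : exists2 y, y \in x :: s & forall z, z \in x :: s -> h z <= h y.
  have [y ys ymax] := @arg_maxnP _ x (mem (x :: s)) h (mem_head _ _).
  by exists y.
have upP z : z \in x :: s -> gadj T z y || gadj T y z -> par y = z.
  move=> zs adj_zy.
  have [//|pz] : par y = z \/ par z = y.
    by case/orP: adj_zy => /adjP[]; auto.
  have nzr : z != r.
    apply: contraTneq adj_zy => zr; move: pz; rewrite zr par_r => <-.
    by rewrite girr.
  by have := desc z nzr; rewrite pz ltnNge ymax.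
have [i p' ri] := rot_to ys.
have memp z : z \in y :: p' -> z \in x :: s by rewrite -ri mem_rot.
have sp' : size (y :: p') = (size s).+1 by rewrite -ri size_rot.
have : cycle (gadj T) (y :: p') by rewrite -ri rot_cycle.
have : uniq (y :: p') by rewrite -ri rot_uniq.
case: p' => [|a [|b p]] in ri memp sp' *; try by move: sp' ss => /= [<-].
rewrite /= rcons_path => /and3P[_ anbp _] /and4P[ya _ _ ly].
have pa : par y = a by apply: upP; [apply: memp; rewrite !inE eqxx orbT | rewrite ya orbT].
have pb : par y = last b p.
  apply: upP; last by rewrite ly.
  by apply: memp; rewrite 2!in_cons mem_last !orbT.
by move: anbp; rewrite -pa pb mem_last.
Qed.

Section TwLeOfRooted.
Variables (G : sgraph) (T : finType) (r : T) (par : T -> T) (h : T -> nat).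
Variables (top : gV G -> T) (B : T -> {set gV G}) (k : nat).
Hypothesis td : rooted_td r par h top B k.

Let e : rel T := [rel a b | (a != b) && ((par a == b) || (par b == a))].

Let e_sym : symmetric e.
Proof. by move=> a b; rewrite /e /= eq_sym orbC. Qed.

Let e_irr : irreflexive e.
Proof. by move=> a; rewrite /e /= eqxx. Qed.

Lemma tw_le_of_rooted : tw_le G k.
Proof.
pose Tg := SGraph e_sym e_irr.
have step t : t != r -> e t (par t).
  move=> ntr; rewrite /e /= eqxx andbT.
  by apply: contraTneq (rtd_desc td ntr) => <-; rewrite ltnn.
exists Tg, B; split; last exact: rtd_width td.
have symc (P : pred T) : connect_sym [rel a b | [&& e a b, P a & P b]].
  by apply: sym_connect_sym => a b /=; rewrite e_sym; congr (_ && _); exact: andbC.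
split.
- split; first by apply/card_gt0P; exists r.
  split; last first.
    apply: (@acyclic_parent Tg r par h (rtd_root td) (rtd_desc td)) => a b /=.
    by case/andP=> _ /orP[]/eqP; auto.
  have toR t : connect e t r.
    have [n] := ubnP (h t); elim: n t => // n IH t /ltnSE hn.
    have [->|ntr] := eqVneq t r; first exact: connect0.
    apply: connect_trans (connect1 (step t ntr)) (IH _ _).
    exact: leq_trans (rtd_desc td ntr) hn.
  move=> x y; apply: connect_trans (toR x) _.
  by rewrite (sym_connect_sym e_sym).
- by move=> v; exists (top v); exact: rtd_top td v.
- exact: rtd_edge td.
- move=> v t1 t2 vt1 vt2.
  have toTop t : v \in B t -> connect [rel a b | [&& e a b, v \in B a & v \in B b]] t (top v).
    have [n] := ubnP (h t); elim: n t => // n IH t /ltnSE hn vt.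
    have [->|ntt] := eqVneq t (top v); first exact: connect0.
    have [ntr vp] := rtd_climb td vt ntt.
    apply: connect_trans (IH _ (leq_trans (rtd_desc td ntr) hn) vp).
    by apply: connect1; have := step _ ntr; rewrite /= vt vp => ->.
  apply: connect_trans (toTop _ vt1) _.
  by rewrite (symc (fun a => v \in B a)); exact: toTop.
Qed.

End TwLeOfRooted.

(** Here [h] is the distance from [r], and [par] picks a neighbour closer to [r]. If an edge ab were
    not a parent edge, the parent edges would still join a and b to [r] without it, and ab would
    close a cycle. *)
Lemma tree_parent (T : sgraph) (r : gV T) : is_tree T ->
  exists (par : gV T -> gV T) (h : gV T -> nat),
    [/\ par r = r, forall t, t != r -> h (par t) < h t &
        forall a b, gadj T a b -> par a = b /\ a != r \/ par b = a /\ b != r].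
Proof.
case=> _ [conT acT].
pose reach t n := [exists s : n.-tuple (gV T), path (gadj T) r s && (last r s == t)].
have reachP t : exists n, reach t n.
  have /connectP[p pp lp] := conT r t.
  by exists (size p); apply/existsP; exists (in_tuple p); rewrite /= pp -lp eqxx.
pose h t := ex_minn (reachP t).
have hstep t : t != r -> exists u, gadj T t u && (h u < h t).
  move=> ntr; rewrite {2}/h; case: ex_minnP => n /existsP[s /andP[ps /eqP ls]] _.
  case/lastP: {s}(tval s) (size_tuple s) ps ls => [|s u] ss.
    by move=> _ /= rt; rewrite rt eqxx in ntr.
  rewrite rcons_path last_rcons => /andP[ps lu] ut; subst u.
  exists (last r s); rewrite gsym lu /= -ss size_rcons ltnS /h.
  case: ex_minnP => m _; apply; apply/existsP; exists (in_tuple s).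
  by rewrite /= ps eqxx.
pose par t := if t == r then r else odflt r [pick u | gadj T t u && (h u < h t)].
have parP t : t != r -> gadj T t (par t) && (h (par t) < h t).
  move=> ntr; rewrite /par (negbTE ntr); case: pickP => [u //|none].
  by have [u] := hstep t ntr; rewrite none.
exists par, h; split; first by rewrite /par eqxx.
  by move=> t /parP/andP[].
move=> a b adj_ab.
have [/andP[/eqP pa ar]|ndab] := boolP ((par a == b) && (a != r)); first by left.
have [/andP[/eqP pb br]|ndba] := boolP ((par b == a) && (b != r)); first by right.
pose e := [rel x y | gadj T x y && ~~ (((x == a) && (y == b)) || ((x == b) && (y == a)))].
have esym : connect_sym e.
  apply: sym_connect_sym => x y /=; rewrite gsym; congr (_ && ~~ _).
  by rewrite orbC andbC; congr (_ || _); rewrite andbC.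
have toR t : connect e t r.
  have [n] := ubnP (h t); elim: n t => // n IH t /ltnSE hn.
  have [->|ntr] := eqVneq t r; first exact: connect0.
  have /andP[adjp hp] := parP t ntr.
  apply: connect_trans (IH _ (leq_trans hp hn)).
  apply: connect1; rewrite /= adjp /= negb_or; apply/andP; split.
    by apply: contra ndab => /andP[/eqP <- ->].
  by apply: contra ndba => /andP[/eqP <- ->].
have : connect e a b by apply: connect_trans (toR a) _; rewrite esym.
case/connectP=> p /shortenP[s ps Us _] bl.
have ss : 1 < size s.
  case: s ps Us bl => [|u [|? ?]] //=.
    by move=> _ _ ab; rewrite ab girr in adj_ab.
  by rewrite andbT => ps _ bu; move: ps; rewrite bu !eqxx andbF.
have pg : path (gadj T) a s by apply: sub_path ps => x y /andP[].
by have := acT a s Us ss pg; rewrite -bl gsym adj_ab.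
Qed.

(** The top of [v] is a node nearest to the root among those whose bag contains [v]. If [v] left its
    bags on the step up from some other node [t], then all its bags reachable from [t] would lie
    below [t], including the top, which is no farther from the root than [t]. *)
Lemma rooted_of_tw_le (G : sgraph) (k : nat) : tw_le G k ->
  exists (T : finType) (r : T) (par : T -> T) (h : T -> nat)
    (top : gV G -> T) (B : T -> {set gV G}), rooted_td r par h top B k.
Proof.
case=> T [B [[treeT cov edges conn] wB]].
have /card_gt0P[r _] := treeT.1.
have [par [h [par_r desc adjP]]] := tree_parent r treeT.
have topP v : exists t, v \in B t /\ forall t', v \in B t' -> h t <= h t'.
  have [t vt] := cov v.
  have [t0 vt0 tmin] := @arg_minnP _ t (fun t => v \in B t) h vt.
  by exists t0.
have [top topE] := choice topP.
exists (gV T), r, par, h, top, B; split=> // [v|v t vt ntt]; first by have [] := topE v.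
have [vtop topmin] := topE v.
have [ntr|] := boolP ((t != r) && (v \in B (par t))); first by move/andP: ntr.
move=> out.
have below u : connect [rel a b | [&& gadj T a b, v \in B a & v \in B b]] t u ->
    u = t \/ h t < h u.
  have closed u' : (exists n, iter n par u' = t) -> u' = t \/ h t < h u'.
    case=> n; elim: n u' => [|n IH] u' /=; first by left.
    rewrite -iterS iterSr => /IH pu.
    have [ur|nur] := eqVneq u' r; first by rewrite ur par_r in pu *.
    by right; have := desc _ nur; case: pu => [->|] //; exact: ltn_trans.
  move=> cu; apply: closed.
  case/connectP: cu => p; elim/last_ind: p u => [|p w IH] u; first by move=> _ /= ->; exists 0.
  rewrite rcons_path last_rcons => /andP[pp /= /and3P[adjw vl vw]] ->.
  have [n En] := IH _ pp erefl.
  case: (adjP _ _ adjw) => [[pl nlr]|[pw _]].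
    case: n En => [|n]; last by rewrite iterSr pl; exists n.
    move=> /= lt; rewrite lt in pl nlr.
    by case/negP: out; rewrite nlr pl.
  by exists n.+1; rewrite iterSr pw.
case: (below _ (conn v t (top v) vt vtop)) => [tt|]; first by rewrite tt eqxx in ntt.
by rewrite ltnNge topmin.
Qed.

(** * Ancestors and packing *)

Section RootedTree.
Variables (T : finType) (r : T) (par : T -> T) (h : T -> nat).
Hypothesis par_r : par r = r.
Hypothesis desc : forall t, t != r -> h (par t) < h t.

Definition anc (x t : T) : Prop := exists n, iter n par t = x.

Lemma anc_refl t : anc t t.
Proof. by exists 0. Qed.

Lemma anc_trans y x t : anc x y -> anc y t -> anc x t.
Proof. by case=> m <- [n <-]; exists (m + n); rewrite iterD. Qed.

Lemma anc_par t : anc (par t) t.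
Proof. by exists 1. Qed.

Lemma anc_iter n t : anc (iter n par t) t.
Proof. by exists n. Qed.

Lemma anc_cases x t : anc x t -> x = t \/ anc x (par t).
Proof. by case=> -[|n] <-; [left | right; exists n; rewrite -iterSr]. Qed.

Lemma par_h t : h (par t) <= h t.
Proof. by have [->|/desc/ltnW] := eqVneq t r; rewrite ?par_r. Qed.

Lemma anc_h x t : anc x t -> h x <= h t.
Proof.
case=> n <-; elim: n => //= n; exact: leq_trans (par_h _).
Qed.

Lemma anc_eq x t : anc x t -> h t <= h x -> x = t.
Proof.
case/anc_cases => // xp hx.
have [tr|/desc] := eqVneq t r; last by have := anc_h xp; lia.
move: xp; rewrite tr par_r => -[n <-].
by elim: n => //= n ->.
Qed.

Lemma anc_root t : anc r t.
Proof.
have [n] := ubnP (h t); elim: n t => // n IH t /ltnSE hn.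
have [->|ntr] := eqVneq t r; first exact: anc_refl.
exact: anc_trans (IH _ (leq_trans (desc ntr) hn)) (anc_par t).
Qed.

Lemma anc_total x y t : anc x t -> anc y t -> anc x y \/ anc y x.
Proof.
case=> m <- [n <-]; case: (leqP m n) => [|/ltnW] /subnK <-; rewrite iterD.
  by right; exact: anc_iter.
by left; exact: anc_iter.
Qed.

Lemma anc_le x y t : anc x t -> anc y t -> h x <= h y -> anc x y.
Proof.
move=> xt yt lexy; case: (anc_total xt yt) => // yx.
by rewrite (anc_eq yx lexy); exact: anc_refl.
Qed.

End RootedTree.

Section RootedDecomp.
Variables (G : sgraph) (T : finType) (r : T) (par : T -> T) (h : T -> nat).
Variables (top : gV G -> T) (B : T -> {set gV G}) (k : nat).
Hypothesis td : rooted_td r par h top B k.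

Let par_r := rtd_root td.
Let desc := rtd_desc td.
Local Notation anc := (anc par).

Lemma bag_top_anc v t : v \in B t -> anc (top v) t.
Proof.
have [n] := ubnP (h t); elim: n t => // n IH t /ltnSE hn vt.
have [->|ntt] := eqVneq t (top v); first exact: anc_refl.
have [ntr vp] := rtd_climb td vt ntt.
apply: anc_trans (anc_par par t); apply: IH vp.
exact: leq_trans (desc ntr) hn.
Qed.

Lemma bag_convex v t x : v \in B t -> anc x t -> anc (top v) x -> v \in B x.
Proof.
move=> vt [n]; elim: n t vt => [|n IH] t vt; first by move=> <-.
rewrite iterSr => px tx.
have [tt|ntt] := eqVneq t (top v); last by apply: IH px tx; case: (rtd_climb td vt ntt).
have /(anc_eq par_r desc) xt : anc x t by exists n.+1; rewrite iterSr.
by rewrite xt // tt; exact: (anc_h par_r desc tx).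
Qed.

Lemma bag_climb v t x : v \in B t -> anc x t -> v \in B x \/ anc x (top v).
Proof.
move=> vt xt; case: (anc_total (bag_top_anc vt) xt) => [tx|]; last by right.
by left; exact: bag_convex vt xt tx.
Qed.

(** Choose [v] in [S] with the deepest top. A neighbour in [S] shares a bag with [v] and has its top
    no deeper, so by convexity it lies in the bag of [top v], which has room for only k vertices
    besides [v]. *)
Lemma degenerate (S : {set gV G}) : S != set0 ->
  exists2 v, v \in S & #|[set u in S | gadj G v u]| <= k.
Proof.
case/set0Pn=> v0 v0S.
have [v vS vmax] := @arg_maxnP _ v0 (mem S) (h \o top) v0S.
exists v => //; rewrite -ltnS; apply: leq_trans (rtd_width td (top v)).
rewrite (cardsD1 v (B (top v))) (rtd_top td) add1n ltnS.
apply/subset_leq_card/subsetP=> u; rewrite !inE => /andP[uS vu].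
apply/andP; split; first by apply: contraTneq vu => ->; rewrite girr.
have [t /andP[vt ut]] := rtd_edge td vu.
apply: (bag_convex ut (bag_top_anc vt)).
apply: (anc_le par_r desc (bag_top_anc ut) (bag_top_anc vt)).
exact: vmax uS.
Qed.

Lemma clique_width (S : {set gV G}) :
  {in S &, forall u v, u != v -> gadj G u v} -> #|S| <= k.+1.
Proof.
move=> clq; have [->|/degenerate[v vS]] := eqVneq S set0; first by rewrite cards0.
move=> dv; rewrite (cardsD1 v) vS add1n ltnS; apply: leq_trans dv.
apply/subset_leq_card/subsetP=> u; rewrite !inE => /andP[nuv uS].
by rewrite uS clq // eq_sym.
Qed.

Definition independent (I : {set gV G}) := {in I &, forall u v, ~~ gadj G u v}.

(** Greedy choice: by degeneracy, each chosen vertex costs at most k+1 vertices, itself and its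
    remaining neighbours. *)
Lemma large_independent (A : {set gV G}) :
  exists2 I : {set gV G}, I \subset A & independent I /\ #|A| <= #|I| * k.+1.
Proof.
have [n] := ubnP #|A|; elim: n A => // n IH A /ltnSE An.
have [->|A0] := eqVneq A set0.
  by exists set0; rewrite ?sub0set // cards0; split=> // u; rewrite inE.
have [v vA dv] := degenerate A0.
pose N := v |: [set u in A | gadj G v u].
have NA : N \subset A.
  by apply/subsetP=> u; rewrite !inE => /orP[/eqP->|/andP[]].
have cN : #|N| <= k.+1.
  by rewrite cardsU1; have := leq_b1 (v \notin [set u in A | gadj G v u]); lia.
have cA : #|A| = #|N| + #|A :\: N| by rewrite -(cardsID N A) (setIidPr NA).
have vN : v \in N by rewrite !inE eqxx.
have N0 : 0 < #|N| by apply/card_gt0P; exists v.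
have [|I IA [indI cI]] := IH (A :\: N); first by lia.
have vI : v \notin I by apply/negP=> /(subsetP IA); rewrite inE vN.
have nvI u : u \in I -> ~~ gadj G v u.
  move/(subsetP IA); rewrite !inE negb_or => /andP[/andP[_ h1] uA].
  by rewrite uA in h1.
exists (v |: I).
  by rewrite subUset sub1set vA (subset_trans IA) ?subsetDl.
split; last by rewrite cardsU1 vI mulSn; lia.
move=> u w; rewrite !inE => /orP[/eqP->|uI] /orP[/eqP->|wI].
- by rewrite girr.
- exact: nvI.
- by rewrite gsym nvI.
- exact: indI.
Qed.

Definition connected_set (A : {set gV G}) :=
  {in A &, forall a b, connect [rel x y | [&& gadj G x y, x \in A & y \in A]] a b}.

Lemma connected_ind (A : {set gV G}) (P : gV G -> Prop) a : connected_set A -> a \in A ->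
  P a -> (forall x y, gadj G x y -> x \in A -> y \in A -> P x -> P y) ->
  {in A, forall b, P b}.
Proof.
move=> conA aA Pa step b bA; have /connectP[p] := conA a b aA bA.
elim/last_ind: p b {bA} => [|p y IH] b; first by move=> _ /= ->.
rewrite rcons_path last_rcons => /andP[pp /= /and3P[adj xA yA]] ->.
exact: step adj xA yA (IH _ pp erefl).
Qed.

Lemma connected_top (A : {set gV G}) : connected_set A -> A != set0 ->
  exists2 v, v \in A & {in A, forall a, anc (top v) (top a)}.
Proof.
move=> conA /set0Pn[v0 v0A].
have [v vA vmin] := @arg_minnP _ v0 (mem A) (h \o top) v0A.
exists v => //; apply: (connected_ind conA vA); first exact: anc_refl.
move=> x y adj xA yA vx; have [t /andP[xt yt]] := rtd_edge td adj.
apply: (anc_le par_r desc) (bag_top_anc yt) (vmin _ yA).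
exact: anc_trans vx (bag_top_anc xt).
Qed.

(** The nodes whose bags meet a connected set form a subtree, so every node between its top and one
    of its nodes is hit. Otherwise all tops of [A] would lie below [x], although that of [v] lies
    above. *)
Lemma connected_hit (A : {set gV G}) v a t x : connected_set A ->
  v \in A -> {in A, forall a, anc (top v) (top a)} ->
  a \in A -> a \in B t -> anc x t -> anc (top v) x -> exists2 b, b \in A & b \in B x.
Proof.
move=> conA vA vtop aA ata xt vx.
apply: contrapT => nohit.
have below b s : b \in A -> b \in B s -> anc x s -> anc x (top b).
  by move=> bA bs xs; case: (bag_climb bs xs) => // bx; case: nohit; exists b.
have xb : {in A, forall b, anc x (top b)}.
  apply: (connected_ind conA aA); first exact: below ata xt.
  move=> y z adj yA zA xy; have [s /andP[ys zs]] := rtd_edge td adj.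
  by apply: below zs _ => //; apply: anc_trans xy (bag_top_anc ys).
case: nohit; exists v => //.
by rewrite (anc_eq par_r desc (xb v vA) (anc_h par_r desc vx)); exact: rtd_top td v.
Qed.

Definition anticomplete (A A' : {set gV G}) :=
  [forall a in A, forall b in A', (a != b) && ~~ gadj G a b].

(* A set whose subtree has a deepest possible top: its top bag hits every set
   which meets or touches it. *)
Lemma packing (l : nat) (P : pred {set gV G}) :
  (forall A, P A -> connected_set A /\ A != set0) ->
  (exists s : seq {set gV G}, [/\ size s = l.+1, all P s & pairwise anticomplete s]) \/
  (exists2 X : {set gV G}, #|X| <= l * k.+1 & forall A, P A -> ~~ [disjoint A & X]).
Proof.
elim: l P => [|l IH] P conP.
  have [[A PA]|noP] := pselect (exists A, P A).
    by left; exists [:: A]; rewrite /= PA.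
  by right; exists set0; rewrite ?cards0 // => A PA; case: noP; exists A.
have [[A0 PA0]|noP] := pselect (exists A, P A); last first.
  by right; exists set0; rewrite ?cards0 // => A PA; case: noP; exists A.
have topP A : exists t, P A -> exists2 v, v \in A & t = top v /\ {in A, forall a, anc t (top a)}.
  have [PA|nPA] := boolP (P A); last by exists r.
  have [conA nA] := conP A PA; have [v vA vtop] := connected_top conA nA.
  by exists (top v) => _; exists v.
have [tp tpE] := choice topP.
have [A PA Amax] := @arg_maxnP _ A0 P (h \o tp) PA0.
have [v vA [tv tpA]] := tpE A PA.
(* The sets that miss the top bag of [A] are anticomplete to [A]. Among them, a packing extends by
   [A], and a hitting set extends by that bag. *)
pose P' C := P C && [disjoint C & B (tp A)].
have antiA C : P' C -> anticomplete A C.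
  case/andP=> PC dis; have [w wC [tw tpC]] := tpE C PC.
  apply/'forall_implyP=> a aA; apply/'forall_implyP=> c cC.
  have [conC _] := conP C PC.
  have noshare t : a \in B t -> c \in B t -> False.
    move=> ta tc.
    have At : anc (tp A) t by apply: anc_trans (tpA a aA) (bag_top_anc ta).
    have Ct : anc (tp C) t by apply: anc_trans (tpC c cC) (bag_top_anc tc).
    have CA : anc (tp C) (tp A) by exact: (anc_le par_r desc Ct At (Amax C PC)).
    rewrite tw in tpC CA.
    have [b bC bA] := connected_hit conC wC tpC cC tc At CA.
    by move/disjoint_setI0/setP/(_ b): dis; rewrite !inE bC bA.
  apply/andP; split.
    by apply/eqP=> ac; apply: (noshare (top a)); rewrite ?ac (rtd_top td).
  by apply/negP=> /(rtd_edge td)[t /andP[]]; exact: noshare.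
have [|[s [ss Ps anti_s]]|[X cX hitX]] := IH P'.
- by move=> C /andP[/conP].
- left; exists (A :: s); split; rewrite /= ?ss ?PA //.
    by apply: sub_all Ps => C /andP[].
  by rewrite anti_s andbT; apply: sub_all Ps.
- right; exists (B (tp A) :|: X).
    by rewrite mulSn; apply: leq_trans (leq_card_setU _ _) (leq_add (rtd_width td _) cX).
  move=> C PC; apply/negP=> dis.
  have PC' : P' C by rewrite /P' PC (disjointWr _ dis) // subsetUl.
  by case/negP: (hitX C PC'); apply: disjointWr dis; exact: subsetUr.
Qed.

End RootedDecomp.

(** * Separators and tree-partitions *)

Lemma card_bigcup_leq (I T : finType) (A : {set I}) (F : I -> {set T}) (m : nat) :
  {in A, forall i, #|F i| <= m} -> #|\bigcup_(i in A) F i| <= #|A| * m.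
Proof.
move=> leFm; rewrite -sum_nat_const.
apply: (@leq_trans (\sum_(i in A) #|F i|)); last exact: leq_sum.
elim/big_rec2: _ => [|i n U _ le]; first by rewrite cards0.
by apply: leq_trans (leq_card_setU _ _) _; rewrite leq_add2l.
Qed.

(** * Lca-closed sets of nodes and the regions they cut out *)

Section LcaClosure.
Variables (T : finType) (r : T) (par : T -> T) (h : T -> nat).
Hypothesis par_r : par r = r.
Hypothesis desc : forall t, t != r -> h (par t) < h t.
Local Notation anc := (anc par).

Definition is_lca (l a b : T) : Prop :=
  [/\ anc l a, anc l b & forall x, anc x a -> anc x b -> anc x l].

Definition lca_closed (M : {set T}) :=
  {in M &, forall a b, exists2 l, l \in M & is_lca l a b}.

Lemma is_lca_sym l a b : is_lca l a b -> is_lca l b a.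
Proof. by case=> la lb lmax; split=> // x xb xa; exact: lmax. Qed.

Lemma is_lca_anc a b : anc a b -> is_lca a a b.
Proof. by move=> ab; split=> //; exact: anc_refl. Qed.

Lemma lca_closedU1 (M : {set T}) s : lca_closed M ->
  {in M, forall m, exists2 l, l \in s |: M & is_lca l s m} -> lca_closed (s |: M).
Proof.
move=> clM sM a b; rewrite !inE => /orP[/eqP->|aM] /orP[/eqP->|bM].
- by exists s; [rewrite !inE eqxx | apply/is_lca_anc/anc_refl].
- exact: sM.
- by have [l lM lsa] := sM a aM; exists l => //; exact: is_lca_sym.
- by have [l lM lab] := clM a b aM bM; exists l => //; rewrite inE lM orbT.
Qed.

(* Besides [s] it suffices to add its deepest ancestor [a] above a node of [M]. *)
Lemma lca_closed_extend (M : {set T}) s : M != set0 -> lca_closed M ->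
  exists M' : {set T}, [/\ M \subset M', s \in M', #|M'| <= #|M| + 2 & lca_closed M'].
Proof.
move=> /set0Pn[m1 m1M] clM.
pose Q x := `[< anc x s /\ exists2 m, m \in M & anc x m >].
have Qr : Q r by apply/asboolP; split; [|exists m1]; rewrite //; exact: (anc_root desc).
have [a /asboolP[a_s [m0 m0M am0]] amax] := @arg_maxnP _ r Q h Qr.
have aM m : m \in M -> exists2 l, l \in a |: M & is_lca l a m.
  move=> mM; have [am|nam] := pselect (anc a m).
    by exists a; [rewrite !inE eqxx | exact: is_lca_anc].
  have [l lM [lm0 lm lmax]] := clM m0 m m0M mM.
  exists l; first by rewrite inE lM orbT.
  split=> // [|x xa xm]; last by apply: lmax xm; exact: anc_trans xa am0.
  by case: (anc_total lm0 am0) => // al; case: nam; exact: anc_trans al lm.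
have cl1 := lca_closedU1 clM aM.
exists (s |: (a |: M)); split.
- by rewrite setUA subsetUr.
- by rewrite !inE eqxx.
- by rewrite !cardsU1; have := leq_b1 (s \notin a |: M); have := leq_b1 (a \notin M); lia.
apply: lca_closedU1 cl1 _ => m; rewrite in_setU1 => /orP[/eqP->|mM].
  by exists a; [rewrite !inE eqxx !orbT | apply/is_lca_sym/is_lca_anc].
have [l lM [la lm lmax]] := aM m mM; exists l; first by rewrite in_setU1 lM orbT.
split=> // [|x xs xm]; first exact: anc_trans la a_s.
apply: lmax => //; apply: (anc_le par_r desc xs a_s); apply: amax.
by apply/asboolP; split=> //; exists m.
Qed.

(** Starting from a single node, every further element of [S] adds at most two nodes. *)
Lemma lca_closure (S : {set T}) : S != set0 ->
  exists M : {set T}, [/\ S \subset M, #|M| <= 2 * #|S| & lca_closed M].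
Proof.
case/set0Pn=> x0 x0S.
have [M [x0M SM cM clM]] : exists M : {set T},
    [/\ x0 \in M, {subset enum (S :\ x0) <= M},
        #|M| <= 1 + 2 * size (enum (S :\ x0)) & lca_closed M].
  elim: (enum _) => [|s e [M [x0M eM cM clM]]].
    exists [set x0]; split; rewrite ?set11 ?cards1 // => a b /set1P-> /set1P->.
    by exists x0; [rewrite set11 | apply/is_lca_anc/anc_refl].
  have M0 : M != set0 by apply/set0Pn; exists x0.
  have [M' [MM' sM' cM' clM']] := lca_closed_extend s M0 clM.
  exists M'; split=> //; first exact: (subsetP MM').
    by move=> y; rewrite inE => /predU1P[->//|/eM]; exact: (subsetP MM').
  by rewrite /=; lia.
rewrite -cardE in cM; have := cardsD1 x0 S; rewrite x0S => cS.
exists M; split=> //; last by lia.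
apply/subsetP=> y yS; have [->//|nyx] := eqVneq y x0.
by apply: SM; rewrite mem_enum !inE nyx.
Qed.

(* [region M t] is the highest node of the component of [t] in the forest
   obtained by deleting [M]. *)
Definition region (M : {set T}) (t : T) : T :=
  iter (\max_x h x) (fun t => if par t \in M then t else par t) t.

Section Region.
Variable M : {set T}.
Let g t := if par t \in M then t else par t.

Let g_anc t : anc (g t) t.
Proof. by rewrite /g; case: ifP => _; [exact: anc_refl | exact: anc_par]. Qed.

Lemma region_anc t : anc (region M t) t.
Proof.
rewrite /region; elim: (\max_x h x) => [|n IH] /=; first exact: anc_refl.
exact: anc_trans (g_anc _) IH.
Qed.

(** Every step that moves strictly lowers [h], so as many iterations as the largest value of [h]
    reach a fixed point. *)
Lemma region_fix t : g (region M t) = region M t.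
Proof.
have desc_g x : g x != x -> h (g x) < h x.
  rewrite /g; case: ifP => _; rewrite ?eqxx // => npx; apply: desc.
  by apply: contraNneq npx => ->; rewrite par_r.
have stays n x : g x = x -> iter n g x = x by move=> gx; elim: n => //= n ->.
have main n x : h x <= n -> g (iter n g x) = iter n g x.
  elim: n x => [|n IH] x hx.
    by have [//|/desc_g] := eqVneq (g x) x; lia.
  rewrite iterSr; have [gx|ngx] := eqVneq (g x) x; first by rewrite gx stays.
  by apply: IH; have := desc_g x ngx; lia.
by apply: main; exact: (leq_bigmax t).
Qed.

Lemma region_par t : par t \notin M -> region M (par t) = region M t.
Proof.
move=> nptM; rewrite -[RHS]region_fix /region.
have gt : par t = g t by rewrite /g (negbTE nptM).
by rewrite [in LHS]gt -/g -iterSr.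
Qed.

Lemma region_notin t : t \notin M -> region M t \notin M.
Proof.
move=> tM; rewrite /region; elim: (\max_x h x) => //= n IH.
by case: ifP => // ->.
Qed.

Lemma region_self t : par t \in M -> region M t = t.
Proof.
move=> ptM; rewrite /region; elim: (\max_x h x) => //= n ->.
by rewrite ptM.
Qed.

(** At most one node of [M] hangs below each region. Otherwise the lca of two such nodes lies in
    [M]. It cannot be above the region's highest node, which is a common ancestor of both, nor
    inside the region, which avoids [M]. *)
Lemma region_unique b c : lca_closed M -> b \in M -> c \in M ->
  par b \notin M -> par c \notin M -> region M (par b) = region M (par c) -> b = c.
Proof.
move=> clM bM cM pb pc rbc.
have [l lM [lb lc lmax]] := clM b c bM cM.
have below x : x \in M -> par x \notin M -> region M (par x) = region M (par b) ->
    anc l x -> l = x.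
  move=> xM px rx /anc_cases[//|lpx].
  have lreg t : t \notin M -> anc l t -> anc l (region M t).
    rewrite /region => tM lt; elim: (\max_x h x) => //= n IH.
    case: ifP => // nM; case: (anc_cases IH) => // lE.
    have : iter n g t \notin M.
      by elim: (n) => //= m Hm; rewrite /g; case: ifP => // ->.
    by rewrite -[iter n g t]lE lM.
  have le1 := lreg _ px lpx; rewrite rx in le1.
  have le2 : anc (region M (par b)) l.
    apply: lmax; first exact: anc_trans (region_anc _) (anc_par _ _).
    by rewrite rbc; exact: anc_trans (region_anc _) (anc_par _ _).
  have lE := anc_eq par_r desc le1 (anc_h par_r desc le2).
  by move: lM; rewrite lE (negbTE (region_notin pb)).
by rewrite -(below b bM pb erefl lb) (below c cM pc (esym rbc) lc).
Qed.

End Region.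
End LcaClosure.

(** * Separators made of the bags of an lca-closed set *)

Section Separator.
Variables (G : sgraph) (T : finType) (r : T) (par : T -> T) (h : T -> nat).
Variables (top : gV G -> T) (B : T -> {set gV G}) (k : nat).
Hypothesis td : rooted_td r par h top B k.

Let par_r := rtd_root td.
Let desc := rtd_desc td.
Local Notation anc := (anc par).
Local Notation region := (region par h).

(** Climbing from [t] through the bags of [z], one either reaches [top z] inside the region or
    leaves the region through the node of [M] just above it. *)
Lemma bag_region (M : {set T}) z t : t \notin M -> z \in B t ->
  (par (region M t) \in M /\ z \in B (par (region M t))) \/
  (top z \notin M /\ region M (top z) = region M t).
Proof.
have [n] := ubnP (h t); elim: n t => // n IH t /ltnSE hn tM zt.
have [tE|ntt] := eqVneq t (top z); first by right; rewrite -tE.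
have [ntr zp] := rtd_climb td zt ntt.
have [pM|npM] := boolP (par t \in M); first by left; rewrite region_self.
by rewrite -(region_par par_r desc npM); apply: IH; rewrite // (leq_trans (desc ntr)).
Qed.

(** The node b is the last one of [M] met when climbing from [m] to [top z] through the bags of
    [z]. *)
Lemma bag_region_below (M : {set T}) z m : m \in M -> z \in B m -> top z \notin M ->
  exists b, [/\ b \in M, par b \notin M, z \in B b & region M (par b) = region M (top z)].
Proof.
have [n] := ubnP (h m); elim: n m => // n IH m /ltnSE hn mM zm zM.
have ntm : m != top z by apply: contraNneq zM => <-.
have [nmr zp] := rtd_climb td zm ntm.
have hp := leq_trans (desc nmr) hn.
have [pM|npM] := boolP (par m \in M); first exact: IH hp pM zp zM.
have [[qM zq]|[_ reg]] := bag_region npM zp; last by exists m; rewrite reg.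
apply: IH qM zq zM; apply: leq_ltn_trans hp.
apply: leq_trans (par_h par_r desc _) _.
exact: (anc_h par_r desc (region_anc par h M (par m))).
Qed.

(* [Z] collects the bags of an lca-closed set of nodes; the nodes of each
   region outside it touch at most two of these: one above and one below. *)
Lemma separator (C S : {set gV G}) : S \subset C -> S != set0 ->
  exists Z : {set gV G}, [/\ S \subset Z, Z \subset C, #|Z| <= 2 * #|S| * k.+1 &
    forall U, connected_set U -> U \subset C :\: Z ->
      exists2 Y : {set gV G}, #|Y| <= 2 * k.+1 &
        {in U & Z, forall u z, gadj G u z -> z \in Y}].
Proof.
move=> SC S0.
have tS0 : top @: S != set0.
  by case/set0Pn: S0 => x xS; apply/set0Pn; exists (top x); exact: imset_f.
have [M [SM cM clM]] := lca_closure par_r desc tS0.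
pose Z := C :&: \bigcup_(m in M) B m.
have inZ z m : z \in C -> m \in M -> z \in B m -> z \in Z.
  by move=> zC mM zm; rewrite inE zC; apply/bigcupP; exists m.
exists Z; split; [|exact: subsetIl| |].
- apply/subsetP=> x xS; apply: (inZ x (top x)); rewrite ?(subsetP SC) ?(rtd_top td) //.
  by apply: (subsetP SM); exact: imset_f.
- apply: leq_trans (subset_leq_card (subsetIr _ _)) _.
  have /card_bigcup_leq cB : {in M, forall m, #|B m| <= k.+1} by move=> m _; exact: rtd_width td m.
  apply: leq_trans cB _; rewrite leq_mul2r; apply/orP; right; apply: leq_trans cM _.
  by rewrite leq_mul2l leq_imset_card orbT.
move=> U conU UCZ; have [->|/set0Pn[u0 u0U]] := eqVneq U set0.
  by exists set0; rewrite ?cards0 // => u z; rewrite inE.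
have offM u t : u \in U -> u \in B t -> t \notin M.
  move=> uU ut; move/(subsetP UCZ): uU; rewrite inE => /andP[nZ uC].
  by apply: contra nZ => tM; exact: inZ tM ut.
have regU u t : u \in U -> u \in B t -> region M t = region M (top u).
  move=> uU; have [n] := ubnP (h t); elim: n t => // n IH t /ltnSE hn ut.
  have [->//|ntt] := eqVneq t (top u).
  have [ntr up] := rtd_climb td ut ntt.
  rewrite -(region_par par_r desc (offM u _ uU up)).
  exact: IH (leq_trans (desc ntr) hn) up.
pose t0 := region M (top u0).
have reg0 : {in U, forall u, region M (top u) = t0}.
  apply: (connected_ind conU u0U) => // x y adj xU yU <-.
  have [t /andP[xt yt]] := rtd_edge td adj.
  by rewrite -(regU x t xU xt) (regU y t yU yt).
(* By [region_unique] this is the only node of [M] hanging below the region of [U]. Together with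
   the node above the region it accounts for the factor 2 in the size of [Y]. *)
pose low := [pick b | [&& b \in M, par b \notin M & region M (par b) == t0]].
exists (B (par t0) :|: (if low is Some b then B b else set0)).
  apply: leq_trans (leq_card_setU _ _) _; rewrite mul2n -addnn leq_add ?(rtd_width td) //.
  by case: low => [b|]; rewrite ?cards0 ?(rtd_width td).
move=> u z uU; rewrite inE => /andP[zC /bigcupP[m mM zm]] /(rtd_edge td)[t /andP[ut zt]].
have rt : region M t = t0 by rewrite (regU u t uU ut) reg0.
rewrite inE; case: (bag_region (offM u t uU ut) zt) => [[_]|[zM]]; rewrite rt.
  by move->.
move=> zt0; have [b [bM pb zb]] := bag_region_below mM zm zM.
rewrite zt0 => rb; apply/orP; right; rewrite /low; case: pickP => [c|/(_ b)].
  case/and3P=> cM' pc /eqP rc.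
  by rewrite (region_unique par_r desc clM cM' bM pc pb) // rc rb.
by rewrite bM pb rb eqxx.
Qed.

End Separator.

(* A partition of [C] into parts of size at most [W], indexed by a rooted tree
   with parent map [q], root [r] and rank [rk]; [S] lies in the root part. The
   tree nodes are named by vertices of [C], which keeps trees built on disjoint
   sets disjoint. *)
Record tree_partition (G : sgraph) (C S : {set gV G}) (W : nat)
    (p q : gV G -> gV G) (rk : gV G -> nat) (r : gV G) : Prop := TreePartition {
  tp_rootC : r \in C;
  tp_partC : {in C, forall x, p x \in C};
  tp_parC : {in C, forall x, q x \in C};
  tp_start : {in S, forall x, p x = r};
  tp_edge : {in C &, forall x y, gadj G x y -> p x = p y \/ p x = q (p y) \/ p y = q (p x)};
  tp_desc : {in C, forall l, l != r -> rk (q l) < rk l};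
  tp_root : q r = r;
  tp_width : forall l, #|[set x in C | p x == l]| <= W }.

Section Glue.
Variables (G : sgraph) (C Z : {set gV G}).
Hypothesis ZC : Z \subset C.

Let D := C :\: Z.
Let relD := [rel x y | [&& gadj G x y, x \in D & y \in D]].

Definition piece (x : gV G) : {set gV G} := [set y | connect relD x y].

Let relD_sym : connect_sym relD.
Proof. by apply: sym_connect_sym => x y /=; rewrite gsym; congr (_ && _); exact: andbC. Qed.

Lemma piece_refl x : x \in piece x.
Proof. by rewrite inE connect0. Qed.

Lemma piece_eq x y : y \in piece x -> piece y = piece x.
Proof.
rewrite inE => xy; apply/setP=> z; rewrite !inE.
by rewrite (same_connect relD_sym xy).
Qed.

Lemma piece_sub x : x \in D -> piece x \subset D.
Proof.
move=> xD; apply/subsetP=> y; rewrite inE => /connectP[s].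
elim/last_ind: s y => [|s z _] y; first by move=> _ /= ->.
by rewrite rcons_path last_rcons => /andP[_ /= /and3P[_ _ zD]] ->.
Qed.

Lemma piece_adj x y : x \in D -> y \in D -> gadj G x y -> y \in piece x.
Proof. by move=> xD yD adj; rewrite inE connect1 //= adj xD yD. Qed.

Lemma piece_connected x : connected_set (piece x).
Proof.
have from b : b \in piece x ->
    connect [rel a b | [&& gadj G a b, a \in piece x & b \in piece x]] x b.
  rewrite inE => /connectP[s]; elim/last_ind: s b => [|s z IH] b.
    by move=> _ /= ->; exact: connect0.
  rewrite rcons_path last_rcons => /andP[ps lz] ->.
  apply: connect_trans (IH _ ps erefl) (connect1 _).
  have xl : connect relD x (last x s) by apply/connectP; exists s.
  rewrite /= !inE xl (connect_trans xl (connect1 lz)) !andbT.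
  by case/and3P: lz.
move=> a b aU bU; apply: connect_trans _ (from b bU).
rewrite (sym_connect_sym _) ?from // => u v /=.
by rewrite gsym; congr (_ && _); exact: andbC.
Qed.

Variables (S : {set gV G}) (W : nat) (r0 : gV G).
Hypothesis SZ : S \subset Z.
Hypothesis r0Z : r0 \in Z.
Hypothesis cZ : #|Z| <= W.
Hypothesis pieces : {in D, forall x, exists p q rk r,
  tree_partition (piece x) [set u in piece x | [exists z in Z, gadj G z u]] W p q rk r}.

(** The set [Z] becomes the root part, named [r0], and the root part of each piece becomes its
    child. No edge from [Z] reaches deeper, since the vertices of a piece adjacent to [Z] were
    forced into its root part. *)
Lemma glue : exists p q rk, tree_partition C S W p q rk r0.
Proof.
pose attach (U : {set gV G}) := [set u in U | [exists z in Z, gadj G z u]].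
(* The choice is indexed by sets and not by vertices, so that all vertices of a piece use the same
   partition. *)
have /choice[F FE] : forall U, exists t : (gV G -> gV G) * (gV G -> gV G) * (gV G -> nat) * gV G,
    (exists2 x, x \in D & U = piece x) ->
    tree_partition U (attach U) W t.1.1.1 t.1.1.2 t.1.2 t.2.
  move=> U; have [[x xD ->]|nU] := pselect (exists2 x, x \in D & U = piece x).
    by have [p [q [rk [r tp]]]] := pieces xD; exists (p, q, rk, r).
  by exists (id, id, fun=> 0, r0) => /nU.
have tpF x : x \in D -> tree_partition (piece x) (attach (piece x)) W
    (F (piece x)).1.1.1 (F (piece x)).1.1.2 (F (piece x)).1.2 (F (piece x)).2.
  by move=> xD; apply: FE; exists x.
pose p x := if x \in Z then r0 else (F (piece x)).1.1.1 x.
pose q l := if l \in Z then r0 else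
  if l == (F (piece l)).2 then r0 else (F (piece l)).1.1.2 l.
(* The names in [Z] other than [r0] label no part, but the parent map must be defined on all of [C];
   they become children of [r0]. *)
pose rk l := if l == r0 then 0 else if l \in Z then 1 else ((F (piece l)).1.2 l).+1.
have inD x : x \in C -> x \notin Z -> x \in D by move=> xC xZ; rewrite inE xZ.
have DZ x : x \in D -> x \notin Z by rewrite inE => /andP[].
have DC x : x \in D -> x \in C by rewrite inE => /andP[].
have pD x : x \in D -> p x \in piece x.
  by move=> xD; rewrite /p (negbTE (DZ x xD)); exact: (tp_partC (tpF x xD) (piece_refl x)).
have pDD x : x \in D -> p x \in D by move=> xD; exact: (subsetP (piece_sub xD) _ (pD x xD)).
have qD l : l \in D -> q l = r0 \/ q l \in piece l.
  move=> lD; rewrite /q (negbTE (DZ l lD)); case: ifP => _; first by left.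
  by right; exact: (tp_parC (tpF l lD) (piece_refl l)).
exists p, q, rk; split.
- exact: (subsetP ZC).
- move=> x xC; have [xZ|xZ] := boolP (x \in Z); first by rewrite /p xZ (subsetP ZC).
  exact: DC (pDD x (inD x xC xZ)).
- move=> l lC; have [lZ|lZ] := boolP (l \in Z); first by rewrite /q lZ (subsetP ZC).
  have lD := inD l lC lZ; case: (qD l lD) => [->|ql]; first exact: (subsetP ZC).
  exact: DC (subsetP (piece_sub lD) _ ql).
- by move=> x /(subsetP SZ) xZ; rewrite /p xZ.
- have cross x y : x \in Z -> y \in D -> gadj G x y -> p x = q (p y).
    move=> xZ yD adj; have pE := piece_eq (pD y yD).
    rewrite /q (negbTE (DZ _ (pDD y yD))) pE.
    have -> : p y = (F (piece y)).2.
      rewrite /p (negbTE (DZ y yD)); apply: (tp_start (tpF y yD)).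
      rewrite inE piece_refl; apply/existsP; exists x; by rewrite xZ adj.
    by rewrite eqxx /p xZ.
  move=> x y xC yC adj.
  have [xZ|/(inD x xC) xD] := boolP (x \in Z); have [yZ|/(inD y yC) yD] := boolP (y \in Z).
  + by left; rewrite /p xZ yZ.
  + by right; left; exact: cross.
  + by right; right; apply: cross; rewrite // gsym.
  have yx := piece_adj xD yD adj; have eqp := piece_eq yx.
  have pxE := piece_eq (pD x xD); have pyE := piece_eq (pD y yD).
  have := tp_edge (tpF x xD) (piece_refl x) yx adj.
  have -> : (F (piece x)).1.1.1 x = p x by rewrite /p (negbTE (DZ x xD)).
  have -> : (F (piece x)).1.1.1 y = p y by rewrite /p (negbTE (DZ y yD)) eqp.
  have rootq := tp_root (tpF x xD).
  (* Only the loop at the root of the piece has been redirected. Where it witnessed an edge, both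
     ends already lie in the same part. *)
  have qE v : v \in D -> piece v = piece x ->
      (F (piece x)).1.1.2 v = q v \/ (F (piece x)).1.1.2 v = v.
    move=> vD vE; rewrite /q (negbTE (DZ v vD)) vE.
    by case: eqP => [->|_]; [right | left].
  have [qx|qx] := qE (p x) (pDD x xD) pxE; have [qy|qy] := qE (p y) (pDD y yD) (etrans pyE eqp);
    rewrite qx qy; intuition.
- move=> l lC nl; rewrite /rk (negbTE nl); have [lZ|lZ] := boolP (l \in Z).
    by rewrite /q lZ eqxx.
  have lD := inD l lC lZ; rewrite /q (negbTE lZ).
  have [_|nlr] := eqVneq l (F (piece l)).2; first by rewrite eqxx.
  have ql := tp_parC (tpF l lD) (piece_refl l).
  have qlD := subsetP (piece_sub lD) _ ql.
  case: ifP => // _; rewrite (negbTE (DZ _ qlD)) (piece_eq ql) ltnS.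
  exact: (tp_desc (tpF l lD) (piece_refl l)).
- by rewrite /q r0Z.
- move=> l; have [lD|lD] := boolP (l \in D).
    apply: leq_trans (tp_width (tpF l lD) l); apply/subset_leq_card/subsetP=> x.
    rewrite inE => /andP[xC /eqP xl].
    have xD : x \in D.
      apply: inD => //; apply/negP=> xZ; move: xl lD; rewrite /p xZ => <-.
      by rewrite inE r0Z.
    have lx : l \in piece x by rewrite -xl; exact: pD.
    rewrite inE (piece_eq lx) piece_refl; apply/eqP.
    by rewrite -[RHS]xl /p (negbTE (DZ x xD)).
  apply: leq_trans cZ; apply/subset_leq_card/subsetP=> x.
  rewrite inE => /andP[xC /eqP xl].
  by apply: contraNT lD => xZ; rewrite -xl; exact: pDD (inD x xC xZ).
Qed.

End Glue.

(** Induction on [C], with the separator of [S] as root part: it has at most 2(k+1) times the size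
    of [S] vertices, whence the width. In each piece the vertices adjacent to the separator are
    neighbours of at most 2(k+1) vertices, so there are at most 2(k+1)d of them and the bound on [S]
    is restored. *)
Lemma tree_partition_exists (G : sgraph) (k d : nat) (C S : {set gV G}) : tw_le G k ->
  {in C, forall v, #|[set u in C | gadj G v u]| <= d} ->
  C != set0 -> S \subset C -> #|S| <= 2 * k.+1 * d + 1 ->
  exists p q rk r, tree_partition C S (2 * (2 * k.+1 * d + 1) * k.+1) p q rk r.
Proof.
move/rooted_of_tw_le=> [T [rt [par [h [top [B td]]]]]].
have [n] := ubnP #|C|; elim: n C S => // n IH C S /ltnSE Cn degC C0.
set m := 2 * k.+1 * d + 1 => SC cS.
(* The separator needs a nonempty [S]. An empty one is replaced by a singleton, which the summand 1
   allows even for d = 0. *)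
wlog S0 : S SC cS / S != set0.
  move=> wlogS; have [SE|] := eqVneq S set0; last exact: wlogS.
  have /set0Pn[x xC] := C0.
  have x1 : [set x] != set0 by apply/set0Pn; exists x; rewrite set11.
  have xC1 : [set x] \subset C by rewrite sub1set.
  have cx : #|[set x]| <= m by rewrite cards1 /m addn1.
  have [p [q [rk [r tp]]]] := wlogS [set x] xC1 cx x1.
  exists p, q, rk, r; case: tp => *; split=> //.
  by move=> y; rewrite SE inE.
have [Z [SZ ZC cZ sepZ]] := separator td SC S0.
have /set0Pn[r0 r0S] := S0; have r0Z := subsetP SZ _ r0S.
suff [p [q [rk tp]]] : exists p q rk, tree_partition C S (2 * m * k.+1) p q rk r0.
  by exists p, q, rk, r0.
apply: (glue ZC SZ r0Z).
  by apply: leq_trans cZ _; rewrite leq_mul2r leq_mul2l cS orbT.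
move=> x xD; have UD := piece_sub xD.
have UC : piece C Z x \subset C by apply: subset_trans UD _; exact: subsetDl.
have [Y cY YZ] := sepZ _ (@piece_connected _ C Z x) UD.
apply: IH.
- apply: leq_trans (proper_card _) Cn; apply/properP; split=> //.
  exists r0; first exact: (subsetP ZC).
  by apply/negP=> /(subsetP UD); rewrite inE r0Z.
- move=> v vU; apply: leq_trans (degC v (subsetP UC _ vU)).
  by apply/subset_leq_card/subsetP=> u; rewrite !inE => /andP[uU ->]; rewrite (subsetP UC) ?inE.
- by apply/set0Pn; exists x; exact: piece_refl.
- by apply/subsetP=> u; rewrite inE => /andP[].
apply: leq_trans (leq_addr 1 _).
apply: (@leq_trans #|\bigcup_(y in Y :&: C) [set u in C | gadj G y u]|).
  apply/subset_leq_card/subsetP=> u; rewrite inE => /andP[uU /exists_inP[z zZ zu]].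
  apply/bigcupP; exists z; rewrite inE; last by rewrite (subsetP UC).
  by rewrite (subsetP ZC) // andbT (YZ u z) // gsym.
apply: leq_trans (@card_bigcup_leq _ _ _ _ d _) _.
  by move=> y; rewrite inE => /andP[_ /degC].
by rewrite leq_mul2r (leq_trans (subset_leq_card (subsetIl _ _)) cY) orbT.
Qed.

(** * Partitions from stars *)

Section RelGraph.
Variables (V : finType) (Q : rel V).

Definition rel_graph_adj : rel V := [rel a b | (a != b) && (Q a b || Q b a)].

Lemma rel_graph_sym : symmetric rel_graph_adj.
Proof. by move=> a b; rewrite /rel_graph_adj /= eq_sym orbC. Qed.

Lemma rel_graph_irr : irreflexive rel_graph_adj.
Proof. by move=> a; rewrite /rel_graph_adj /= eqxx. Qed.

Definition rel_graph : sgraph := SGraph rel_graph_sym rel_graph_irr.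

End RelGraph.

(** The decomposition tree is the forest of [q] below a new root [None] with bag [X]; the node of x
    has bag [X] with x and its parent added. With [X] empty this covers forests, with one vertex a
    forest plus an apex: the indexing graphs of the upper bounds, and paths, stars and fans. *)
Lemma tw_le_forest_apex (J : sgraph) (X : {set gV J}) (q : gV J -> gV J) (rk : gV J -> nat)
    (k : nat) :
  (forall x, q x = x \/ rk (q x) < rk x) ->
  (forall x y, gadj J x y -> [\/ x \in X, y \in X, y = q x | x = q y]) ->
  #|X| <= k.+1 -> (forall x, #|X :|: [set x; q x]| <= k.+1) -> tw_le J k.
Proof.
move=> qrk adjq cX cB.
pose par t := if t is Some x then if q x == x then None else Some (q x) else None.
pose B t := if t is Some x then X :|: [set x; q x] else X.
pose top v := if v \in X then None else Some v.
apply: (@tw_le_of_rooted J _ None par (fun t => if t is Some x then (rk x).+1 else 0) top B).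
have XB x t : x \in X -> x \in B t by case: t => [y|] //=; rewrite inE => ->.
split=> // [[x|] //= _|v|v [x|]|v w adj|[x|] //].
- by case: eqP => // nq; case: (qrk x).
- by rewrite /top; case: ifP => [/XB//|_]; rewrite /= !inE eqxx orbT.
- rewrite /top /B; case: ifP => [vX _ _|vX]; first by split=> //; exact: (XB v (par (Some x))).
  rewrite !inE vX /= => /orP[/eqP->|/eqP->]; first by rewrite eqxx.
  move=> nx; split=> //; case: eqP => [qx|_]; last by rewrite !inE eqxx orbT.
  by rewrite qx eqxx in nx.
- by rewrite /top /B => ->.
case: (adjq _ _ adj) => [vX|wX|->|->].
- by exists (Some w); rewrite /= !inE vX eqxx !orbT.
- by exists (Some v); rewrite /= !inE wX eqxx !orbT.
- by exists (Some v); rewrite /= !inE !eqxx !orbT.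
- by exists (Some w); rewrite /= !inE !eqxx !orbT.
exact: cB.
Qed.

Lemma tpw_le_mono (G : sgraph) (c c' w w' : nat) :
  c <= c' -> w <= w' -> tpw_le c G w -> tpw_le c' G w'.
Proof.
move=> lec lew [J [p [twJ adjp wp]]]; exists J, p; split=> //; first exact: leq_trans lec.
by move=> x; exact: leq_trans lew.
Qed.

Lemma tpw_le_trivial (G : sgraph) : tpw_le 0 G #|gV G|.
Proof.
exists (@rel_graph unit (fun _ _ => false)), (fun=> tt); split; last by move=> x; exact: max_card.
  apply/tw_leP/(@tw_le_forest_apex _ set0 id (fun=> 0)); first by left.
  - by move=> [] [].
  - by rewrite cards0.
  - by move=> x; rewrite set0U setUid cards1.
by left.
Qed.

Section FromTreePartition.
Variables (G : sgraph) (C S : {set gV G}) (W : nat).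
Variables (p q : gV G -> gV G) (rk : gV G -> nat) (r : gV G).
Hypothesis tp : tree_partition C S W p q rk r.

(** The indexing graph uses all of V(G) as names, so those outside [C] are made isolated roots. *)
Let q' l := if l \in C then q l else l.

Let q'_rk l : q' l = l \/ rk (q' l) < rk l.
Proof.
rewrite /q'; case: ifP => [lC|]; last by left.
have [->|/(tp_desc tp lC)] := eqVneq l r; first by left; exact: tp_root tp.
by right.
Qed.

Let q'_part x : x \in C -> q' (p x) = q (p x).
Proof. by move=> xC; rewrite /q' (tp_partC tp xC). Qed.

Lemma tpw_le_tree : C = setT -> tpw_le 1 G W.
Proof.
move=> CT; have inC x : x \in C by rewrite CT inE.
pose J := rel_graph (fun a b => b == q' a).
exists J, p; split.
- apply/tw_leP/(@tw_le_forest_apex J set0 q' rk) => //.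
  + by move=> x y /andP[_ /orP[/eqP|/eqP]]; [constructor 3 | constructor 4].
  + by rewrite cards0.
  + by move=> x; rewrite set0U cards2; case: eqP.
- move=> v u adj; have [->|npp] := eqVneq (p v) (p u); first by left.
  right; rewrite /= /rel_graph_adj /= npp !q'_part //=.
  by case: (tp_edge tp (inC v) (inC u) adj) npp => [->|[->|->]]; rewrite ?eqxx ?orbT.
- by move=> l; have := tp_width tp l; rewrite CT; under eq_finset do rewrite inE.
Qed.

Lemma tpw_le_apex_tree : tpw_le 2 G (W + #|~: C|).
Proof.
pose Q (a b : option (gV G)) := match a, b with Some x, Some y => y == q' x | _, _ => true end.
exists (rel_graph Q), (fun x => if x \in C then Some (p x) else None); split.
- apply/tw_leP; pose rk' (t : option (gV G)) := if t is Some x then rk x else 0.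
  apply: (@tw_le_forest_apex (rel_graph Q) [set None] (omap q') rk').
  + by move=> [x|] /=; [case: (q'_rk x) => [->|]; auto | left].
  + move=> [x|] [y|] /=; rewrite /rel_graph_adj /= ?andbT.
    * by move=> /andP[_ /orP[/eqP->|/eqP->]]; [constructor 3 | constructor 4].
    * by constructor 2; rewrite inE.
    * by constructor 1; rewrite inE.
    * by [].
  + by rewrite cards1.
  + by move=> x; rewrite cardsU1 cards2; case: (_ \notin _); case: (_ != _).
- move=> v u adj; case: ifP => vC; case: ifP => uC; rewrite /= /rel_graph_adj /=; auto.
  have [->|npp] := eqVneq (p v) (p u); first by left.
  right; rewrite (inj_eq Some_inj) npp !q'_part //=.
  by case: (tp_edge tp vC uC adj) npp => [->|[->|->]]; rewrite ?eqxx ?orbT.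
move=> [l|].
  apply: leq_trans (leq_addr _ _); apply: leq_trans (tp_width tp l).
  by apply/subset_leq_card/subsetP=> x; rewrite !inE; case: ifP.
apply: leq_trans (leq_addl _ _); apply/subset_leq_card/subsetP=> x.
by rewrite !inE; case: ifP.
Qed.

End FromTreePartition.

(* [star_structure c] says that [H] is a star forest in which [c x] is the
   centre of the component of [x]. *)
Definition star_structure (H : sgraph) (c : gV H -> gV H) :=
  (forall x, c (c x) = c x) /\
  (forall x y, gadj H x y = (c x == c y) && ((x == c x) (+) (y == c y))).

Definition star_leaves (H : sgraph) (c : gV H -> gV H) (x : gV H) : {set gV H} :=
  [set y | (c y == c x) && (y != c x)].

(** * Induced stars and embeddings of star forests *)

Section Kstar.
Variables (G : sgraph) (s : nat).

Definition star_with_centre (A : {set gV G}) (c : gV G) : bool :=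
  [&& c \in A, #|A :\ c| == s, [forall y in A :\ c, gadj G c y] &
      [forall y in A :\ c, forall z in A :\ c, ~~ gadj G y z]].

Definition is_kstar (A : {set gV G}) : bool := [exists c, star_with_centre A c].

Lemma star_with_centreP (A : {set gV G}) c : reflect
  [/\ c \in A, #|A :\ c| = s, {in A :\ c, forall y, gadj G c y} &
      {in A :\ c &, forall y z, ~~ gadj G y z}] (star_with_centre A c).
Proof.
apply: (iffP and4P) => [] [cA sA cy yz]; split=> //.
- exact/eqP.
- exact/forall_inP.
- by move=> y z yA zA; move/forall_inP: yz => /(_ y yA)/forall_inP; exact.
- exact/eqP.
- exact/forall_inP.
- by apply/forall_inP=> y yA; apply/forall_inP=> z zA; exact: yz.
Qed.

Lemma kstar_connected (A : {set gV G}) : is_kstar A -> connected_set A /\ A != set0.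
Proof.
case/existsP=> c /star_with_centreP[cA _ cy _]; split; last by apply/set0Pn; exists c.
have fromc b : b \in A -> connect [rel x y | [&& gadj G x y, x \in A & y \in A]] c b.
  move=> bA; have [->|nbc] := eqVneq b c; first exact: connect0.
  by apply: connect1; rewrite /= cA bA cy // !inE nbc.
move=> a b aA bA; apply: connect_trans _ (fromc b bA).
rewrite (sym_connect_sym _) ?fromc // => u v /=.
by rewrite gsym; congr (_ && _); exact: andbC.
Qed.

Lemma kstar_in (C : {set gV G}) v (I : {set gV G}) : v \in C -> I \subset C ->
  {in I, forall u, gadj G v u} -> independent I -> s <= #|I| ->
  exists2 A, is_kstar A & A \subset C.
Proof.
move=> vC IC vI indI sI.
pose L := [set x in take s (enum I)].
have LI x : x \in L -> x \in I by rewrite inE => /mem_take; rewrite mem_enum.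
have vL : v \notin L by apply/negP=> /LI/vI; rewrite girr.
have cL : #|L| = s.
  rewrite cardsE (card_uniqP _) ?take_uniq ?enum_uniq // size_take -cardE.
  by case: ltnP => //; lia.
have LE : (v |: L) :\ v = L by rewrite setU1K.
exists (v |: L); last first.
  by rewrite subUset sub1set vC; apply/subsetP=> x /LI /(subsetP IC).
apply/existsP; exists v; apply/star_with_centreP; rewrite LE; split=> //.
- by rewrite !inE eqxx.
- by move=> y /LI/vI.
- by move=> y z /LI yI /LI zI; exact: indI.
Qed.

End Kstar.

(** A larger neighbourhood would contain an independent set of s vertices, which together with v
    induces a star. *)
Lemma kstar_free_degree (G : sgraph) (k s : nat) (C : {set gV G}) : tw_le G k ->
  (forall A, is_kstar s A -> ~~ (A \subset C)) ->
  {in C, forall v, #|[set u in C | gadj G v u]| <= s * k.+1}.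
Proof.
move/rooted_of_tw_le=> [T [rt [par [h [top [B td]]]]]] free v vC.
have [I IN [indI cN]] := large_independent td [set u in C | gadj G v u].
apply: leq_trans cN _; rewrite leq_mul2r; apply/orP; right.
rewrite leqNgt; apply/negP=> /ltnW sI.
have inN u : u \in I -> u \in C /\ gadj G v u.
  by move/(subsetP IN); rewrite inE => /andP.
have [||A] := kstar_in vC _ _ indI sI.
- by apply/subsetP=> u /inN[].
- by move=> u /inN[].
by move/free/negP.
Qed.

Lemma anticomplete_sym (G : sgraph) (A A' : {set gV G}) :
  anticomplete A A' -> anticomplete A' A.
Proof.
move/forall_inP=> anti; apply/forall_inP=> b bA; apply/forall_inP=> a aA.
by have /forall_inP/(_ b bA) := anti a aA; rewrite eq_sym gsym.
Qed.

(** Each component of [H] goes into its own star, centre to centre and leaves to leaves in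
    enumeration order. The image is induced because the stars are induced and pairwise
    anticomplete. *)
Lemma star_forest_embedding (H G : sgraph) (c : gV H -> gV H) (s : nat)
    (As : seq {set gV G}) :
  star_structure c -> #|c @: setT| <= size As -> (forall x, #|star_leaves c x| <= s) ->
  all (is_kstar s) As -> pairwise (@anticomplete G) As -> induced_sub H G.
Proof.
move=> [cc adjH] cAs leaves starAs antiAs.
pose idx x := index (c x) (enum (c @: setT)).
have idx_lt x : idx x < size As.
  apply: leq_trans cAs; rewrite cardE index_mem mem_enum; exact: imset_f.
have idx_inj x y : idx x = idx y -> c x = c y.
  by move=> E; apply: (index_inj (c x) _ _ E); rewrite mem_enum; exact: imset_f.
pose K x := nth set0 As (idx x).
have starK x : is_kstar s (K x) by exact: (all_nthP _ starAs).
have eqK x y : c x = c y -> K x = K y by rewrite /K /idx => ->.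
have antiK x y : c x != c y -> anticomplete (K x) (K y).
  move=> nxy; have nidx : idx x != idx y by apply: contra nxy => /eqP/idx_inj->.
  have /(pairwiseP set0) anti := antiAs; case: (ltngtP (idx x) (idx y)) nidx => // lt _.
    exact: (anti _ _ (idx_lt x) (idx_lt y) lt).
  by apply: anticomplete_sym; exact: (anti _ _ (idx_lt y) (idx_lt x) lt).
(* A star with one leaf has two possible centres; fixing one per set makes all vertices of a
   component agree. *)
have [ctr ctrK] : exists ctr : {set gV G} -> option (gV G),
    forall A, is_kstar s A -> exists2 v, ctr A = Some v & star_with_centre s A v.
  exists (fun A => [pick v | star_with_centre s A v]) => A /existsP[v sv].
  by case: pickP => [u su|/(_ v)]; [exists u | rewrite sv].
have /choice[f fE] : forall x, exists v, exists2 o, ctr (K x) = Some o &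
    star_with_centre s (K x) o /\ v = if x == c x then o else
      nth o (enum (K x :\ o)) (index x (enum (star_leaves c x))).
  move=> x; have [o oE so] := ctrK _ (starK x).
  by eexists; exists o.
have leafP x o : star_with_centre s (K x) o -> x != c x ->
    nth o (enum (K x :\ o)) (index x (enum (star_leaves c x))) \in K x :\ o.
  case/star_with_centreP=> oK sK _ _ nxc; rewrite -mem_enum mem_nth // -cardE sK.
  by apply: leq_trans (leaves x); rewrite cardE index_mem mem_enum inE eqxx nxc.
have fK x : f x \in K x.
  have [o _ [so ->]] := fE x; case: eqP => [_|/eqP nxc].
    by case/star_with_centreP: so.
  by have := leafP x o so nxc; rewrite inE => /andP[].
have main x y : (f x == f y) = (x == y) /\ gadj G (f x) (f y) = gadj H x y.
  rewrite adjH; have [cxy|ncxy] := eqVneq (c x) (c y); last first.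
    have /forall_inP/(_ _ (fK x))/forall_inP/(_ _ (fK y))/andP[ne na] := antiK x y ncxy.
    rewrite (negbTE ne) (negbTE na); split=> //.
    by symmetry; apply: contra_neqF ncxy => /eqP->.
  have [o oE [so ->]] := fE x; have [o' oE' [so' ->]] := fE y.
  have ox : o' = o by apply: Some_inj; rewrite -oE -oE' (eqK x y).
  rewrite {o' oE'}ox in so' *.
  have /star_with_centreP[oK sK oadj leafind] := so.
  have neo v : v \in K x :\ o -> (v == o) = false by rewrite in_setD1 => /andP[/negbTE->].
  have lyK : y != c y -> nth o (enum (K y :\ o)) (index y (enum (star_leaves c y))) \in K x :\ o.
    by move=> ny; rewrite (eqK x y cxy); exact: leafP.
  have lxK := leafP x o so.
  case: (eqVneq x (c x)) => xc; case: (eqVneq y (c y)) => yc.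
  - by rewrite eqxx girr xc yc cxy eqxx.
  - rewrite eq_sym neo ?lyK // oadj ?lyK //; split=> //.
    by symmetry; apply/negbTE; rewrite xc cxy eq_sym.
  - rewrite neo ?lxK // gsym oadj ?lxK //; split=> //.
    by symmetry; apply/negbTE; rewrite yc -cxy.
  split; last by apply/negbTE/leafind; rewrite ?lyK ?lxK.
  have lv z : z != c z -> c z = c x -> index z (enum (star_leaves c x)) < s /\
      z \in enum (star_leaves c x).
    move=> zc czx; have zl : z \in enum (star_leaves c x) by rewrite mem_enum inE -czx eqxx zc.
    by split=> //; apply: leq_trans (leaves x); rewrite cardE index_mem.
  have -> : star_leaves c y = star_leaves c x by rewrite /star_leaves cxy.
  have [ix xl] := lv x xc erefl; have [iy yl] := lv y yc (esym cxy).
  rewrite -(eqK x y cxy) nth_uniq ?enum_uniq -?cardE ?sK //.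
  by apply/eqP/eqP=> [E|->//]; exact: (index_inj x xl yl E).
exists f; split=> [x y /eqP|x y]; last by case: (main x y).
by rewrite (main x y).1 => /eqP.
Qed.

(** A packing of l+1 stars would contain [H], so the other outcome of [packing] holds. *)
Lemma star_free_modulo (H G : sgraph) (c : gV H -> gV H) (l s k : nat) :
  star_structure c -> #|c @: setT| <= l.+1 -> (forall x, #|star_leaves c x| <= s) ->
  tw_le G k -> I_ H G ->
  exists2 X : {set gV G}, #|X| <= l * k.+1 & forall A, is_kstar s A -> ~~ (A \subset ~: X).
Proof.
move=> stH cl leaves /rooted_of_tw_le[T [rt [par [h [top [B td]]]]]] noH.
have [[As [sAs starAs antiAs]]|[X cX hit]] := packing td l (@kstar_connected G s).
  by case: noH; apply: (star_forest_embedding stH _ leaves starAs antiAs); rewrite sAs.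
by exists X => // A /hit; rewrite -disjoints_subset.
Qed.

(** * Upper bounds on the underlying treewidth *)

Section UpperBounds.
Variables (H : sgraph) (c : gV H -> gV H) (l s : nat).
Hypothesis stH : star_structure c.
Hypothesis centres : #|c @: setT| <= l.+1.
Hypothesis leaves : forall x, #|star_leaves c x| <= s.

Let hit G := @star_free_modulo H G c l s (tw G) stH centres leaves (proj1 (tw_leP G _) (leqnn _)).

Let twG G : tw_le G (tw G) := proj1 (tw_leP G _) (leqnn _).

(** The width in [tree_partition_exists] for the degree bound d = s(k+1). *)
Let width k := 2 * (2 * k.+1 * (s * k.+1) + 1) * k.+1.

Lemma utw_witness2 : utw_witness (I_ H) 2.
Proof.
exists (fun k => width k + l * k.+1) => G /hit[X cX free].
(* A tree-partition needs a nonempty set; if nothing is left outside [X], a single part suffices. *)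
have [C0|C0] := eqVneq (~: X) set0.
  have XT : X = setT by rewrite -[X]setCK C0 setC0.
  apply: tpw_le_mono (tpw_le_trivial G) => //.
  by rewrite -cardsT -XT; exact: leq_trans cX (leq_addl _ _).
have deg := kstar_free_degree (twG G) free.
have [||p [q [rk [r tp]]]] := @tree_partition_exists G _ _ (~: X) set0 (twG G) deg C0.
- exact: sub0set.
- by rewrite cards0.
apply: tpw_le_mono (leqnn _) _ (tpw_le_apex_tree tp).
by rewrite setCK leq_add2l.
Qed.

(** With one component the hitting set is empty, so no apex is added to the tree. *)
Lemma utw_witness1_star : l = 0 -> utw_witness (I_ H) 1.
Proof.
move=> l0; exists width => G /hit[X]; rewrite l0 mul0n leqn0 cards_eq0 => /eqP-> free.
rewrite setC0 in free.
have [C0|C0] := eqVneq [set: gV G] set0.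
  by apply: tpw_le_mono (tpw_le_trivial G) => //; rewrite -cardsT C0 cards0.
have deg := kstar_free_degree (twG G) free.
have [||p [q [rk [r tp]]]] := @tree_partition_exists G _ _ setT set0 (twG G) deg C0.
- exact: sub0set.
- by rewrite cards0.
exact: tpw_le_tree tp erefl.
Qed.

(** Every single vertex is a star without leaves, so the hitting set is all of V(G) and the order of
    [G] is bounded. *)
Lemma utw_witness0_independent : s = 0 -> utw_witness (I_ H) 0.
Proof.
move=> s0; exists (fun k => l * k.+1) => G /hit[X cX free].
have XT : X = setT.
  apply/setP=> v; rewrite inE; apply/negbNE/negP=> vX.
  have := free [set v]; rewrite sub1set inE vX s0 => /(_ _)/negP; apply=> //.
  apply/existsP; exists v; apply/star_with_centreP; rewrite set11 setDv cards0.
  by split=> // y; rewrite inE.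
by apply: tpw_le_mono (tpw_le_trivial G) => //; rewrite -cardsT -XT.
Qed.

Section Cluster.
Variables (G : sgraph) (C : {set gV G}).
Hypothesis s2 : s = 2.
Hypothesis free : forall A : {set gV G}, is_kstar s A -> ~~ (A \subset C).

(** Otherwise y would be the centre of an induced star with the two leaves x and z. *)
Lemma cluster_trans x y z : x \in C -> y \in C -> z \in C ->
  gadj G x y -> gadj G y z -> x != z -> gadj G x z.
Proof.
move=> xC yC zC xy yz nxz; apply: contrapT => /negP nadj.
have [||||A /free/negP//] := @kstar_in G s C y [set x; z] yC.
- by apply/subsetP=> u /set2P[]->.
- by move=> u /set2P[]->; rewrite // gsym.
- by move=> u v /set2P[]-> /set2P[]->; rewrite ?girr // gsym.
- by rewrite cards2 nxz s2.
Qed.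

Definition cluster x := [set y in C | (y == x) || gadj G x y].

Lemma cluster_eq x y : x \in C -> y \in C -> gadj G x y -> cluster x = cluster y.
Proof.
have sub u v : u \in C -> v \in C -> gadj G u v -> cluster u \subset cluster v.
  move=> uC vC uv; apply/subsetP=> w; rewrite !inE => /andP[wC].
  rewrite wC /= => /orP[/eqP->|uw]; first by rewrite gsym uv orbT.
  have [//|nwv] := eqVneq w v; apply: cluster_trans uw _ => //; first by rewrite gsym.
  by rewrite eq_sym.
move=> xC yC xy; apply/eqP; rewrite eqEsubset !sub //.
by rewrite gsym.
Qed.

Lemma cluster_width (U : {set gV G}) : #|[set x in C | cluster x == U]| <= (tw G).+1.
Proof.
have [T [rt [par [h [top [B td]]]]]] := rooted_of_tw_le (twG G).
apply: (clique_width td) => u v; rewrite !inE => /andP[uC /eqP uU] /andP[vC /eqP vU] nuv.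
have : v \in cluster u by rewrite uU -vU !inE vC eqxx.
by rewrite !inE vC eq_sym (negbTE nuv).
Qed.

End Cluster.

Lemma utw_witness1_cluster : s = 2 -> utw_witness (I_ H) 1.
Proof.
move=> s2; exists (fun k => k.+1 + l * k.+1) => G /hit[X cX free].
pose C := ~: X; pose J := rel_graph (fun a b : option {set gV G} => ~~ a || ~~ b).
exists J, (fun x => if x \in C then Some (cluster C x) else None); split.
- apply/tw_leP; pose q (t : option {set gV G}) : option {set gV G} := None.
  apply: (@tw_le_forest_apex J set0 q (fun t => if t is Some _ then 1 else 0)).
  + by case=> [x|]; [right | left].
  + by move=> [x|] [y|]; rewrite /= /rel_graph_adj /= ?andbF // => _; [constructor 3 | constructor 4].
  + by rewrite cards0.
  + by move=> x; rewrite set0U cards2; case: eqP.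
- move=> v u adj; case: ifP => vC; case: ifP => uC; rewrite /= /rel_graph_adj /=; auto.
  by left; rewrite (cluster_eq s2 free vC uC adj).
move=> [U|].
  apply: leq_trans (leq_addr _ _); apply: leq_trans (cluster_width C U).
  by apply/subset_leq_card/subsetP=> x; rewrite !inE; case: ifP.
apply: leq_trans (leq_addl _ _); apply: leq_trans cX.
by apply/subset_leq_card/subsetP=> x; rewrite !inE; case: (x \in X).
Qed.

Lemma utw_witness0_cluster : l = 0 -> s = 2 -> utw_witness (I_ H) 0.
Proof.
move=> l0 s2; exists succn => G /hit[X].
rewrite l0 mul0n leqn0 cards_eq0 => /eqP->; rewrite setC0 => free.
pose J := rel_graph (fun _ _ : {set gV G} => false); exists J, (cluster setT); split.
- apply/tw_leP/(@tw_le_forest_apex J set0 id (fun=> 0)); first by left.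
  + by move=> x y; rewrite /= /rel_graph_adj /= andbF.
  + by rewrite cards0.
  + by move=> x; rewrite set0U setUid cards1.
- by move=> v u adj; left; apply: (cluster_eq s2 free).
move=> U; apply: leq_trans (cluster_width setT U).
by apply/subset_leq_card/subsetP=> x; rewrite !inE.
Qed.

End UpperBounds.

(** * Star forests *)

Section Components.
Variable H : sgraph.

Lemma component_refl (x : gV H) : x \in component x.
Proof. by rewrite inE connect0. Qed.

Lemma component_eq (x y : gV H) : y \in component x -> component y = component x.
Proof.
rewrite inE => xy; apply/setP=> z; rewrite !inE.
by rewrite (same_connect (sym_connect_sym (@gsym H)) xy).
Qed.

Lemma component_adj (x y : gV H) : gadj H x y -> y \in component x.
Proof. by move=> xy; rewrite inE connect1. Qed.

Lemma component_min (x : gV H) (D : {set gV H}) : x \in D ->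
  (forall u v, u \in D -> gadj H u v -> v \in D) -> component x \subset D.
Proof.
move=> xD closed; apply/subsetP=> y; rewrite inE => /connectP[p].
elim/last_ind: p y => [|p w IH] y; first by move=> _ ->.
rewrite rcons_path last_rcons => /andP[pp lw] ->.
exact: closed (IH _ pp erefl) lw.
Qed.

Lemma star_onE (C : {set gV H}) c y z :
  (forall y z, y \in C -> z \in C ->
    (gadj H y z <-> ((y == c) && (z != c)) || ((z == c) && (y != c)))) ->
  y \in C -> z \in C -> gadj H y z = (y == c) (+) (z == c).
Proof.
move=> adjC yC zC; have {}adjC := adjC y z yC zC.
have -> : gadj H y z = ((y == c) && (z != c)) || ((z == c) && (y != c)).
  by apply/idP/idP => /adjC.
by case: (y == c); case: (z == c).
Qed.

(** Centres are chosen per component, as a set, because an isolated edge has two candidates. The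
    last clause serves to count leaves when components are small. *)
Lemma star_forest_structure : star_forest H -> exists c : gV H -> gV H,
  star_structure c /\
  forall x, c x \in component x /\ star_leaves c x \subset component x :\ c x.
Proof.
move=> sf; have /choice[g gE] : forall C : {set gV H}, exists o : option (gV H),
    star_on C -> exists2 c, o = Some c & c \in C /\ forall y z, y \in C -> z \in C ->
    (gadj H y z <-> ((y == c) && (z != c)) || ((z == c) && (y != c))).
  move=> C; have [[c cC adjC]|nC] := pselect (star_on C); last by exists None.
  by exists (Some c) => _; exists c.
pose c x := odflt x (g (component x)).
have cP x : c x \in component x /\ forall y z, y \in component x -> z \in component x ->
    (gadj H y z <-> ((y == c x) && (z != c x)) || ((z == c x) && (y != c x))).
  by rewrite /c; have [o -> []] := gE _ (sf x).
have c_eq x y : y \in component x -> c y = c x.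
  by move=> yx; rewrite /c (component_eq yx); have [o -> _] := gE _ (sf x).
have comp_c x y : c x = c y -> y \in component x.
  move=> cxy; rewrite -(component_eq (cP x).1) cxy (component_eq (cP y).1).
  exact: component_refl.
exists c; split; last first.
  move=> x; split; first exact: (cP x).1.
  apply/subsetP=> y; rewrite !inE => /andP[/eqP cyx ->] /=.
  by have := comp_c _ _ (esym cyx); rewrite inE.
split=> [x|x y]; first exact: c_eq (cP x).1.
have [cxy|ncxy] := eqVneq (c x) (c y); last first.
  by apply: contraNF ncxy => /component_adj/c_eq->.
have yx := comp_c _ _ cxy.
by rewrite (star_onE (cP x).2 (component_refl x) yx) cxy.
Qed.

Lemma star_structure_star : is_star H -> exists c : gV H -> gV H,
  star_structure c /\ #|c @: setT| <= 1.
Proof.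
case=> c cT adjC; exists (fun=> c); split; last first.
  rewrite -(cards1 c); apply/subset_leq_card/subsetP=> x /imsetP[y _ ->].
  exact: set11.
split=> // x y; rewrite (star_onE adjC) ?inE // eqxx.
by [].
Qed.

Lemma star_structure_independent : no_edges H -> star_structure (id : gV H -> gV H).
Proof. by move=> noE; split=> // x y; rewrite (negbTE (noE x y)) !eqxx andbF. Qed.

Lemma no_edges_leaves x : #|star_leaves (id : gV H -> gV H) x| = 0.
Proof. by apply/eqP; rewrite cards_eq0; apply/eqP/setP=> y; rewrite !inE andbN. Qed.

(** The centre is the middle vertex of a path on three vertices, and the first vertex of a shorter
    one. *)
Lemma path_star_on (C : {set gV H}) : path_on C -> #|C| <= 3 -> star_on C.
Proof.
case=> s [s0 Us sC adjC] cC; have ss : size s <= 3.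
  by rewrite -(card_uniqP Us) -cardsE sC.
have inC x : x \in C -> x \in s by rewrite -sC inE.
case: s s0 Us sC adjC ss inC => [//|a [|b [|d [|? ?]]]] //= _ Us sC adjC _ inC.
- exists a; first by rewrite -sC !inE eqxx.
  move=> y z yC zC; move: (inC y yC) (inC z zC); rewrite !inE => /eqP-> /eqP->.
  by rewrite girr eqxx.
- exists a; first by rewrite -sC !inE eqxx.
  move: Us; rewrite inE andbT => ab.
  move=> y z yC zC; rewrite adjC //.
  have yE := inC y yC; have zE := inC z zC; rewrite !inE in yE zE.
  split.
    case=> -[|i] [//= _ [[ay bz]|[az b_y]]]; subst.
      by rewrite eqxx eq_sym ab.
    by rewrite eqxx eq_sym ab orbT.
  case/orP=> /andP[/eqP -> nz]; exists 0; split=> //=.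
    by left; move: zE; rewrite (negbTE nz) /= => /eqP->.
  by right; move: yE; rewrite (negbTE nz) /= => /eqP->.
exists b; first by rewrite -sC !inE eqxx orbT.
move: Us; rewrite !inE negb_or andbT => /andP[/andP[ab ad] bd] y z yC zC.
rewrite adjC //; have yE := inC y yC; have zE := inC z zC; rewrite !inE in yE zE.
split.
  case=> -[|[|i]] [//= _ [[e1 e2]|[e1 e2]]]; subst.
  - by rewrite eqxx ab orbT.
  - by rewrite eqxx ab.
  - by rewrite eqxx eq_sym bd.
  - by rewrite eqxx eq_sym bd orbT.
case/orP=> /andP[/eqP -> nz].
  move: zE; rewrite (negbTE nz) /= => /orP[]/eqP->; first by exists 0; split=> //=; right.
  by exists 1; split=> //=; left.
move: yE; rewrite (negbTE nz) /= => /orP[]/eqP->; first by exists 0; split=> //=; left.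
by exists 1; split=> //=; right.
Qed.

Lemma star_path_on (C : {set gV H}) : star_on C -> #|C| <= 3 -> path_on C.
Proof.
case=> c cC adjC cC3; have adjE y z := star_onE (y := y) (z := z) adjC.
have cL : #|C :\ c| <= 2 by have := cardsD1 c C; rewrite cC; lia.
have CE : c |: C :\ c = C by rewrite setD1K.
case: (enum (C :\ c)) (mem_enum (C :\ c)) (enum_uniq (C :\ c)) (cardE (C :\ c)) =>
    [|a [|b [|? ?]]] /= enC Uen cen; last by rewrite cen in cL.
- have inC y : (y \in C) = (y == c) by rewrite -CE in_setU1 -enC orbF.
  exists [:: c]; split=> //; first by apply/setP=> y; rewrite !inE inC.
  move=> y z yC zC; rewrite adjE //; move: yC zC; rewrite !inC => /eqP-> /eqP->.
  rewrite eqxx; split=> // -[i [//]].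
- have inC y : (y \in C) = (y \in [:: c; a]) by rewrite -CE in_setU1 -enC !inE.
  have ac : (a == c) = false.
    by have := enC a; rewrite !inE eqxx => /esym/andP[/negbTE].
  exists [:: c; a]; split=> //; first by rewrite /= inE eq_sym ac.
    by apply/setP=> y; rewrite inE inC.
  move=> y z yC zC; rewrite adjE //; move: yC zC; rewrite !inC !inE.
  move=> yE zE; split.
    case/orP: yE => /eqP->; case/orP: zE => /eqP->; rewrite ?eqxx ?ac // => _; exists 0.
      by split=> //=; left.
    by split=> //=; right.
  by case=> -[|i] [//= _ [[<- <-]|[<- <-]]]; rewrite eqxx ac.
have inC y : (y \in C) = (y \in [:: a; c; b]).
  by rewrite -CE in_setU1 -enC !inE orbCA.
have ac : (a == c) = false.
  by have := enC a; rewrite !inE eqxx => /esym/andP[/negbTE].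
have bc : (b == c) = false.
  by have := enC b; rewrite !inE eqxx orbT => /esym/andP[/negbTE].
have ab : (a == b) = false by move: Uen; rewrite inE andbT => /negbTE.
exists [:: a; c; b]; split=> //; first by rewrite /= !inE ac ab eq_sym bc.
  by apply/setP=> y; rewrite inE inC.
move=> y z yC zC; rewrite adjE //; move: yC zC; rewrite !inC !inE.
move=> yE zE; split.
  case/or3P: yE => /eqP->; case/or3P: zE => /eqP->; rewrite ?eqxx ?ac ?bc // => _.
  - by exists 0; split=> //=; left.
  - by exists 0; split=> //=; right.
  - by exists 1; split=> //=; left.
  - by exists 1; split=> //=; right.
by case=> -[|[|i]] [//= _ [[<- <-]|[<- <-]]]; rewrite eqxx ?ac ?bc.
Qed.

(* Excluding triangles, induced 4-vertex paths and induced 4-cycles leaves every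
   edge with an endpoint of degree one. *)
Lemma star_forest_of_forbidden :
  (forall a b c : gV H, gadj H a b -> gadj H b c -> gadj H a c -> False) ->
  (forall a b c d : gV H, gadj H a b -> gadj H b c -> gadj H c d ->
     a != c -> b != d -> ~~ gadj H a c -> ~~ gadj H b d -> False) ->
  star_forest H.
Proof.
move=> noTri noWalk x.
pose leaf u v := forall w, gadj H u w -> w = v.
have edge u v : gadj H u v -> leaf u v \/ leaf v u.
  move=> uv; apply: contrapT => /not_orP[/existsNP[w /not_implyP[uw nwv]]].
  move=> /existsNP[z /not_implyP[vz nzu]].
  apply: (noWalk w u v z) => //; rewrite 1?gsym //.
  - exact/eqP.
  - by rewrite eq_sym; exact/eqP.
  - by apply/negP=> vw; apply: (noTri u v w).
  - by rewrite gsym; apply/negP=> uz; apply: (noTri u v z).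
(* If all neighbours of x have degree one, x is the centre. Otherwise some neighbour has another
   neighbour; then x has degree one and that neighbour is the centre. *)
have [c cx cleaf] : exists2 c, x = c \/ gadj H c x & forall u, gadj H c u -> leaf u c.
  have [xleaf|] := pselect (forall u, gadj H x u -> leaf u x); first by exists x; auto.
  move=> /existsNP[y /not_implyP[xy nyx]].
  have xy_leaf : leaf x y by case: (edge x y xy).
  exists y; first by right; rewrite gsym.
  move=> u yu; case: (edge y u yu) => // yleaf.
  by case: nyx => w yw; rewrite (yleaf w yw) -(yleaf x) // gsym.
have inE_c y : y \in component x -> y = c \/ gadj H c y.
  have /subsetP sub : component x \subset c |: [set y | gadj H c y].
    apply: component_min; first by rewrite !inE; case: cx => [->|->]; rewrite ?eqxx ?orbT.
    move=> u v; rewrite !inE => /orP[/eqP->->|/cleaf cu /cu->]; last by rewrite eqxx.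
    by rewrite orbT.
  by move/sub; rewrite !inE => /orP[/eqP|]; auto.
exists c.
  by case: cx => [->|cx]; [exact: component_refl | apply: component_adj; rewrite gsym].
have cN y : gadj H c y -> (y == c) = false.
  by move=> cy; apply: contraTF cy => /eqP->; rewrite girr.
move=> y z /inE_c[->|cy] /inE_c[->|cz].
- by rewrite girr eqxx.
- by rewrite cz eqxx (cN z cz).
- by rewrite gsym cy eqxx (cN y cy).
rewrite (cN y cy) (cN z cz); split=> // yz.
by move: (cN z cz); rewrite (cleaf y cy z yz) eqxx.
Qed.

End Components.

(** * Lower bounds *)

Lemma tw_degenerate (J : sgraph) (c : nat) (S : {set gV J}) : tw J <= c -> S != set0 ->
  exists2 v, v \in S & #|[set u in S | gadj J v u]| <= c.
Proof. by move/tw_leP/rooted_of_tw_le=> [T [r [par [h [top [B td]]]]]]; exact: degenerate td S. Qed.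

(** The image of [g] would induce minimum degree above c in [J], against degeneracy; further edges
    of [J] do no harm. *)
Lemma no_dense_image (J : sgraph) (c : nat) (I : finType) (i0 : I) (g : I -> gV J) (F : rel I) :
  tw J <= c -> injective g -> (forall i j, F i j -> gadj J (g i) (g j)) ->
  (forall i, c < #|[set j | F i j]|) -> False.
Proof.
move=> twJ injg Fadj dense.
have S0 : g @: setT != set0 by apply/set0Pn; exists (g i0); exact: imset_f.
have [_ /imsetP[i _ ->]] := tw_degenerate twJ S0.
apply/negP; rewrite -ltnNge; apply: leq_trans (dense i) _.
rewrite -(card_imset _ injg); apply/subset_leq_card/subsetP=> _ /imsetP[j Fij ->].
by rewrite !inE imset_f //= Fadj //; rewrite inE in Fij.
Qed.

Lemma utw_witness_mono (C : gclass) (c c' : nat) : c <= c' -> utw_witness C c -> utw_witness C c'.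
Proof. by move=> lec [f fE]; exists f => G /fE; exact: tpw_le_mono. Qed.

(** The maximum of [f] over the treewidths 0 to m gives one width for all these graphs, fixed before
    a test graph is chosen. *)
Lemma utw_witness_width (C : gclass) (c m : nat) : utw_witness C c ->
  exists w, forall G, C G -> tw_le G m -> tpw_le c G w.
Proof.
case=> f fE; exists (\max_(i < m.+1) f i) => G CG /tw_leP twG.
apply: tpw_le_mono (leqnn c) _ (fE G CG); rewrite -ltnS in twG.
exact: (leq_bigmax (Ordinal twG)).
Qed.

Lemma val_insub_bseq (m : nat) (T : Type) (s : seq T) :
  size s <= m -> insub_bseq m s = s :> seq T.
Proof. by move=> sm; rewrite /insub_bseq val_insubd sm. Qed.

Section PrefixGraph.
Variables (F : rel nat) (m N : nat).

(* For [F := (fun i j => i != j)] this is the closure of the complete [N]-ary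
   tree of depth [m]; a general [F] filters its edges by the two depths. *)
Definition prefix_graph : sgraph :=
  rel_graph (fun s t : m.-bseq 'I_N => prefix s t && F (size s) (size t)).

(** The words form the decomposition tree, the parent deleting the last letter. The bag of a word
    holds its prefixes, which are told apart by their lengths 0 to m. *)
Lemma prefix_graph_tw : tw_le prefix_graph m.
Proof.
have par_size (t : m.-bseq 'I_N) : size (take (size t).-1 t) <= m.
  by rewrite size_take_min (leq_trans (geq_minr _ _)) // size_bseq.
pose par t := Bseq (par_size t).
pose B (t : m.-bseq 'I_N) : {set gV prefix_graph} := [set v : m.-bseq 'I_N | prefix v t].
apply: (@tw_le_of_rooted prefix_graph _ [bseq] par (fun t => size t) id B); split.
- exact: val_inj.
- move=> t nt; rewrite size_take_min.
  have : 0 < size t by rewrite lt0n size_eq0; apply: contraNneq nt => t0; apply/eqP/val_inj.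
  by case: (size t) => // n _; rewrite gtn_min /= ltnSn.
- by move=> v; rewrite inE prefix_refl.
- move=> v t; rewrite inE => vt nvt.
  have lt : size v < size t.
    rewrite ltnNge; apply: contra nvt => le; apply/eqP/val_inj => /=.
    by move: vt; rewrite prefixE take_oversize // => /eqP.
  split; first by apply: contraTneq lt => ->.
  by rewrite inE prefixE /= take_takel -?prefixE // -ltnS (ltn_predK lt).
- move=> v w; rewrite /= /rel_graph_adj /= => /andP[_ /orP[]/andP[vw _]].
    by exists w; rewrite !inE vw prefix_refl.
  by exists v; rewrite !inE vw prefix_refl.
move=> t; pose f (v : m.-bseq 'I_N) : 'I_m.+1 := inord (size v).
rewrite -[m.+1]card_ord -(@card_in_imset _ _ f); first exact: max_card.
move=> v w; rewrite !inE !prefixE => /eqP vt /eqP wt /(congr1 val).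
by rewrite /= !inordK ?ltnS ?size_bseq // => vw; apply: val_inj; rewrite /= -vt -wt vw.
Qed.

Variables (J : sgraph) (p : gV prefix_graph -> gV J) (w : nat).
Hypothesis widthp : forall x, #|[set v | p v == x]| <= w.
Hypothesis largeN : m * w < N.

Let P (s : seq 'I_N) := p (insub_bseq m s).

(** The parts met so far are at most m in number and hold at most m w vertices, fewer than the N
    children of the current word, so some child lies in a new part. *)
Lemma prefix_branch j : j <= m -> exists s : seq 'I_N, size s = j /\
  {in gtn j.+1 &, injective (fun i => P (take i s))}.
Proof.
elim: j => [|j IH] jm.
  by exists [::]; split=> // i i'; rewrite !inE !ltnS !leqn0 => /eqP-> /eqP->.
have [s [ss injs]] := IH (ltnW jm).
pose fibres := \bigcup_(i in [set: 'I_j.+1]) [set v | p v == P (take i s)].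
have [a aP] : exists a, insub_bseq m (rcons s a) \notin fibres.
  apply: contrapT => none; have : #|'I_N| <= #|fibres|.
    have inj : injective (fun a => insub_bseq m (rcons s a)).
      move=> a b /(congr1 val) /=; rewrite !val_insub_bseq ?size_rcons ?ss //.
      exact: rcons_injr.
    rewrite -(card_imset _ inj); apply/subset_leq_card/subsetP=> _ /imsetP[a _ ->].
    by apply: contrapT => /negP na; apply: none; exists a.
  have /card_bigcup_leq cF : {in [set: 'I_j.+1], forall i : 'I_j.+1,
    #|[set v | p v == P (take i s)]| <= w} by [].
  move/leq_trans/(_ cF); rewrite cardsT !card_ord leqNgt => /negP; apply.
  by apply: leq_ltn_trans largeN; rewrite leq_mul2r jm orbT.
exists (rcons s a); split; first by rewrite size_rcons ss.
have old i : i < j.+1 -> take i (rcons s a) = take i s.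
  by move=> ij; rewrite -cats1 takel_cat // ss.
have new : take j.+1 (rcons s a) = rcons s a by rewrite take_oversize // size_rcons ss.
have fresh i : i < j.+1 -> P (take i s) <> P (rcons s a).
  move=> ij E; case/negP: aP; apply/bigcupP; exists (Ordinal ij) => //.
  by rewrite inE /= E.
move=> i i'; rewrite !inE => hi hi' /=.
have [ij|ij] := ltnP i j.+1; have [i'j|i'j] := ltnP i' j.+1.
- by rewrite !old //; exact: injs.
- have -> : i' = j.+1 by lia.
  by rewrite (old _ ij) new => E; case: (fresh i ij E).
- have -> : i = j.+1 by lia.
  by rewrite (old _ i'j) new => E; case: (fresh i' i'j (esym E)).
- by move=> _; lia.
Qed.

End PrefixGraph.

Lemma prefix_graph_unbounded (F : rel nat) (C : gclass) :
  (forall i j, odd i != odd j -> F i j) -> (forall m N, C (prefix_graph F m N)) ->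
  ~ bounded_utw C.
Proof.
move=> Fodd CG [c /(@utw_witness_width _ _ c.+1.*2)[w wE]].
(* Levels 0 to 2c+2 contain at least c+1 of each parity, so each level is joined to more than c
   others. *)
set m := c.+1.*2 in wE.
have [J [p [twJ adjp widthp]]] := wE _ (CG m (m * w).+1) (prefix_graph_tw F m (m * w).+1).
have [s [ss injs]] := prefix_branch widthp (ltnSn _) (leqnn m).
pose g (i : 'I_m.+1) := p (insub_bseq m (take i s)).
have injg : injective g by move=> i j /injs E; apply/val_inj/E; rewrite inE.
apply: (@no_dense_image J c 'I_m.+1 ord0 g [rel i j : 'I_m.+1 | odd i != odd j] twJ injg).
  have main (i j : 'I_m.+1) : i < j -> odd i != odd j -> gadj J (g i) (g j).
    move=> ij oddij.
    have [||//] := adjp (insub_bseq m (take i s)) (insub_bseq m (take j s)).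
      have sz (t : 'I_m.+1) : size (take t s) = t by rewrite size_takel // ss -ltnS.
      have val_t (t : 'I_m.+1) : insub_bseq m (take t s) = take t s :> seq _.
        by rewrite val_insub_bseq // sz -ltnS.
      rewrite /= /rel_graph_adj /= -val_eqE /= !val_t !sz Fodd // prefixE sz.
      rewrite take_takel ?(ltnW ij) // eqxx /= andbT.
      by apply: contraTneq ij => /(congr1 size); rewrite !sz => ->; rewrite ltnn.
    by move/injg=> E; rewrite E eqxx in oddij.
  move=> i j /= oddij; case: (ltngtP i j) => [ij|ji|E].
  - exact: main.
  - by rewrite gsym; apply: main; rewrite // eq_sym.
  - by rewrite E eqxx in oddij.
move=> i; pose f (k : 'I_c.+1) : 'I_m.+1 := inord (k.*2 + ~~ odd i).
have fE (k : 'I_c.+1) : f k = k.*2 + ~~ odd i :> nat.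
  by rewrite /f inordK // /m; have := ltn_ord k; have := leq_b1 (~~ odd i); lia.
have injf : injective f.
  by move=> k k' E; apply: val_inj => /=; have := fE k; rewrite E fE; lia.
rewrite -[c.+1]card_ord -(card_imset _ injf); apply/subset_leq_card/subsetP.
move=> _ /imsetP[k _ ->]; rewrite inE /= fE oddD odd_double /= oddb.
by case: (odd i).
Qed.

(** If [H] is not a star-forest it contains one of the forbidden patterns, so one of the two prefix
    graphs always lies in the class. The parity version is bipartite and has no triangle; in the
    closure, comparability of prefixes excludes the four-vertex walks. *)
Lemma bounded_star_forest (H : sgraph) : bounded_utw (I_ H) -> star_forest H.
Proof.
move=> bd; apply: star_forest_of_forbidden => [a b c ab bc ac|a b c d ab bc cd nac nbd ac bd'].
  apply: (@prefix_graph_unbounded (fun i j => odd i != odd j)) bd => // m N [f [_ adjf]].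
  move: ab bc ac; rewrite -!adjf /= /rel_graph_adj /= => /andP[_ ab] /andP[_ bc] /andP[_ ac].
  have oddE s t : (prefix s t && (odd (size s) != odd (size t)))
      || (prefix t s && (odd (size t) != odd (size s))) -> odd (@size 'I_N s) != odd (@size 'I_N t).
    by case/orP=> /andP[_] //; rewrite eq_sym.
  move: (oddE _ _ ab) (oddE _ _ bc) (oddE _ _ ac).
  by case: (odd (size (f a))); case: (odd (size (f b))); case: (odd (size (f c))).
apply: (@prefix_graph_unbounded (fun i j => i != j)) bd => [i j|m N [f [injf adjf]]].
  by apply: contraNneq => ->.
have adj_prefix x y : gadj H x y -> prefix (f x) (f y) \/ prefix (f y) (f x).
  rewrite -adjf /= /rel_graph_adj /= => /andP[_ /orP[]/andP[-> _]]; auto.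
have prefix_adj x y : prefix (f x) (f y) -> x != y -> gadj H x y.
  move=> xy nxy; rewrite -adjf /= /rel_graph_adj /= (inj_eq injf) nxy xy /=.
  apply/orP; left; apply: contraNneq nxy => sxy; apply/eqP/injf/val_inj => /=.
  by move: xy; rewrite prefixE sxy take_size => /eqP.
have comparable x y z : prefix (f x) (f z) -> prefix (f y) (f z) -> x != y -> gadj H x y.
  move=> xz yz nxy; wlog le : x y xz yz nxy / size (f x) <= size (f y).
    by move=> W; case: (leqP (size (f x)) (size (f y))) => [|/ltnW] le;
       [|rewrite gsym]; apply: W; rewrite // eq_sym.
  apply: prefix_adj nxy; move: xz yz; rewrite !prefixE => /eqP xz /eqP <-.
  by rewrite take_takel // xz.
(* If z were a prefix of y, then x and z would be comparable, hence adjacent. Applied from both ends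
   of the walk, this makes b and c prefixes of each other. *)
have down x y z : gadj H x y -> gadj H y z -> x != z -> ~~ gadj H x z -> prefix (f y) (f z).
  move=> xy yz nxz nadj; case: (adj_prefix _ _ yz) => // zy.
  case/negP: nadj; case: (adj_prefix _ _ xy) => [xy'|yx]; first exact: comparable zy nxz.
  by rewrite gsym; apply: prefix_adj; [exact: prefix_trans zy yx | rewrite eq_sym].
have bc' := down _ _ _ ab bc nac ac.
have cb' : prefix (f c) (f b) by apply: (down d c b); rewrite 1?gsym // 1?eq_sym // gsym.
have : f b = f c.
  apply: val_inj => /=; move: (bc') (cb'); rewrite !prefixE => /eqP E1 /eqP E2.
  have : size (f b) = size (f c) by apply/eqP; rewrite eqn_leq !size_prefix.
  by move=> E; rewrite -E1 E take_size.
by move/injf=> E; rewrite E girr in bc.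
Qed.

(** * Test graphs: paths, stars and fans *)

Definition path_graph (n : nat) : sgraph := rel_graph (fun i j : 'I_n.+1 => j == i.+1 :> nat).

Definition star_graph (n : nat) : sgraph := rel_graph (fun a _ : option 'I_n => ~~ a).

Definition fan_rel (n : nat) (a b : option 'I_n) : bool :=
  if (a, b) is (Some i, Some j) then j == i.+1 :> nat else true.

Definition fan (n : nat) : sgraph := rel_graph (@fan_rel n).

Lemma path_graph_adj (n : nat) (i j : gV (path_graph n)) :
  gadj (path_graph n) i j -> (j : nat) = (i : nat).+1 \/ (i : nat) = (j : nat).+1.
Proof. by rewrite /= /rel_graph_adj /= => /andP[_ /orP[]/eqP]; auto. Qed.

Lemma path_graph_tw (n : nat) : tw_le (path_graph n) 1.
Proof.
pose q (i : 'I_n.+1) : 'I_n.+1 := inord i.-1.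
have qE (i : 'I_n.+1) : q i = i.-1 :> nat.
  by rewrite inordK // (leq_ltn_trans (leq_pred i)).
apply: (@tw_le_forest_apex (path_graph n) set0 q (fun i : 'I_n.+1 => i)).
- move=> i; have [i0|i0] := posnP i; [left | right]; last by rewrite qE; lia.
  by apply: val_inj; rewrite /= qE i0.
- move=> i j /path_graph_adj[E|E]; [constructor 4 | constructor 3];
    by apply: val_inj; rewrite /= qE E.
- by rewrite cards0.
- by move=> x; rewrite set0U cards2; case: eqP.
Qed.

Lemma star_graph_tw (n : nat) : tw_le (star_graph n) 1.
Proof.
pose q (a : option 'I_n) : option 'I_n := None.
apply: (@tw_le_forest_apex (star_graph n) set0 q
  (fun a : option 'I_n => if a is Some _ then 1 else 0)).
- by case=> [i|]; [right | left].
- by move=> [i|] [j|]; rewrite /= /rel_graph_adj /= ?andbF // => _; [constructor 3 | constructor 4].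
- by rewrite cards0.
- by move=> x; rewrite set0U cards2; case: eqP.
Qed.

Lemma fan_tw (n : nat) : tw_le (fan n) 2.
Proof.
pose pr (i : 'I_n) : 'I_n := Ordinal (leq_ltn_trans (leq_pred i) (ltn_ord i)).
apply: (@tw_le_forest_apex (fan n) [set None] (omap pr)
  (fun a : option 'I_n => if a is Some i then i : nat else 0)).
- move=> [i|] /=; last by left.
  have [i0|i0] := posnP i; [left | right]; last by rewrite /=; lia.
  by congr Some; apply: val_inj; rewrite /= i0.
- move=> [i|] [j|]; rewrite /= /rel_graph_adj //=.
  + move=> /andP[_ /orP[]/eqP E]; [constructor 4 | constructor 3];
    by congr Some; apply: val_inj; rewrite /= E.
  + by constructor 2; rewrite inE.
  + by constructor 1; rewrite inE.
- by rewrite cards1.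
- by move=> x; rewrite cardsU1 cards2; case: (_ \notin _); case: (_ != _).
Qed.

(** An indexing graph of treewidth 0 has no edges, so a connected graph stays within one part. *)
Lemma tpw0_connected (G : sgraph) (w : nat) (x : gV G) : (forall y, connect (gadj G) x y) ->
  tpw_le 0 G w -> #|gV G| <= w.
Proof.
move=> conG [J [p [twJ adjp widthp]]]; apply: leq_trans (widthp (p x)).
rewrite -cardsT; apply/subset_leq_card/subsetP=> y _; rewrite inE.
have noedge a b : gadj J a b -> False.
  move=> ab; have S0 : [set a; b] != set0 by apply/set0Pn; exists a; rewrite set21.
  have [v vS] := tw_degenerate twJ S0; rewrite leqn0 cards_eq0 => /eqP/setP E.
  case/set2P: vS E => -> E; [have := E b | have := E a]; rewrite !inE eqxx ?orbT ?ab //.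
  by rewrite gsym ab.
have /connectP[s] := conG y; elim/last_ind: s y => [|s z IH] y; first by move=> _ ->.
rewrite rcons_path last_rcons => /andP[ps lz] ->.
by rewrite -(eqP (IH _ ps erefl)); case: (adjp _ _ lz) => [->//|/noedge].
Qed.

(** A connected star on w+1 vertices does not fit into one part of width w, so it cannot belong to
    the class. *)
Lemma star_graph_sub (H : sgraph) : utw_witness (I_ H) 0 -> exists n, induced_sub H (star_graph n).
Proof.
case/(@utw_witness_width _ _ 1)=> w wE; exists w; apply: contrapT => noH.
have := tpw0_connected (x := None : gV (star_graph w)) _ (wE _ noH (star_graph_tw w)).
rewrite card_option card_ord ltnn => /(_ _)/notF; apply.
by case=> [i|]; [apply: connect1 | exact: connect0].
Qed.

Lemma path_graph_sub (H : sgraph) : utw_witness (I_ H) 0 -> exists n, induced_sub H (path_graph n).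
Proof.
case/(@utw_witness_width _ _ 1)=> w wE; exists w; apply: contrapT => noH.
have := tpw0_connected (x := ord0 : gV (path_graph w)) _ (wE _ noH (path_graph_tw w)).
rewrite card_ord ltnn => /(_ _)/notF; apply.
case=> i; elim: i => [|i IH] hi; first by rewrite (_ : Ordinal hi = ord0) //; exact: val_inj.
apply: connect_trans (IH (ltnW hi)) (connect1 _).
by rewrite /= /rel_graph_adj /= -val_eqE /= eqxx andbT neq_ltn ltnSn.
Qed.

Lemma leaves_in_path (n : nat) (i a b d : gV (path_graph n)) :
  gadj (path_graph n) i a -> gadj (path_graph n) i b -> gadj (path_graph n) i d ->
  a != b -> b != d -> d != a -> False.
Proof.
move=> /path_graph_adj ia /path_graph_adj ib /path_graph_adj id.
rewrite -!val_eqE /= => nab nbd nda; lia.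
Qed.

(** As an induced subgraph of a star, [H] with an edge contains the centre and is itself a star; as
    an induced subgraph of a path it has at most two leaves. *)
Lemma utw0_necessary (H : sgraph) : utw_witness (I_ H) 0 ->
  (path_on [set: gV H] /\ #|gV H| <= 3) \/ no_edges H.
Proof.
move=> wit; have [n [f [injf adjf]]] := star_graph_sub wit.
have [m [g [injg adjg]]] := path_graph_sub wit.
have [noE|edges] := pselect (no_edges H); [by right | left].
move: edges => /existsNP[x /existsNP[y /negP]]; rewrite negbK => xy.
have [c fc] : exists c, f c = None.
  move: xy; rewrite -adjf /= /rel_graph_adj /=.
  by case Ex: (f x) => [i|]; case Ey: (f y) => [j|]; rewrite //= ?andbF // => _; eexists; eassumption.
have noneE z : (f z == None) = (z == c) by rewrite -fc (inj_eq injf).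
have adjH u v : gadj H u v = ((u == c) && (v != c)) || ((v == c) && (u != c)).
  rewrite -adjf /= /rel_graph_adj /= -!noneE.
  by case: (f u) => [i|]; case: (f v) => [j|]; rewrite //= andbF.
have starH : star_on [set: gV H] by exists c; rewrite ?inE // => u v _ _; rewrite adjH.
suff H3 : #|[set: gV H]| <= 3 by split; [exact: star_path_on | rewrite -cardsT].
rewrite (cardsD1 c) inE add1n ltnS leqNgt; apply/card_gt2P=> -[a [b [d [[aL bL dL] [ab bd da]]]]].
have cadj z : z \in [set: gV H] :\ c -> gadj (path_graph m) (g c) (g z).
  by rewrite !inE andbT adjg adjH eqxx => ->.
by apply: (leaves_in_path (cadj a aL) (cadj b bL) (cadj d dL)); rewrite (inj_eq injg).
Qed.

(** Cut the path of the fan into w+1 blocks of w+1 vertices. The part of the apex cannot meet every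
    block. Along a block that it misses, a change of part would create a triangle in the indexing
    forest, so the block lies in one part, which is too small for it. *)
Lemma fan_sub (H : sgraph) : utw_witness (I_ H) 1 -> exists n, induced_sub H (fan n).
Proof.
case/(@utw_witness_width _ _ 2)=> w wE; pose n := w.+1 * w.+1; exists n.
apply: contrapT => noH; have [J [p [twJ adjp widthp]]] := wE _ noH (fan_tw n).
have idx_lt (j e : 'I_w.+1) : j * w.+1 + e < n.
  by rewrite /n; have := ltn_ord j; have := ltn_ord e; nia.
pose idx j e : 'I_n := Ordinal (idx_lt j e).
have idx_div j e : idx j e %/ w.+1 = j by rewrite /= divnMDl // divn_small ?addn0.
have idx_injr j : injective (idx j) by move=> e e' /(congr1 val) /= /addnI/val_inj.
pose P i := p (Some i).
have crowded (h : 'I_w.+1 -> 'I_n) x : injective h -> (forall e, P (h e) = x) -> False.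
  move=> injh hx; have := widthp x; apply/negP; rewrite -ltnNge.
  rewrite -[w.+1]card_ord -(card_imset _ (inj_comp Some_inj injh)).
  by apply/subset_leq_card/subsetP=> _ /imsetP[e _ ->]; rewrite inE; apply/eqP/hx.
have [j jP] : exists j, forall e, P (idx j e) != p None.
  apply: contrapT => /forallNP all_hit.
  have /choice[e eP] : forall j, exists e, P (idx j e) = p None.
    move=> j; apply: contrapT => none; apply: (all_hit j) => e.
    by apply/eqP=> E; apply: none; exists e.
  apply: (crowded (fun j => idx j (e j))) eP => i i' E.
  by apply: val_inj; rewrite /= -(idx_div i (e i)) E idx_div.
(* Otherwise the parts of the apex and of the two path vertices form a triangle, whose minimum
   degree 2 exceeds the treewidth bound 1. *)
have flat (i i' : 'I_n) : i' = i.+1 :> nat -> P i != p None -> P i' != p None -> P i = P i'.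
  move=> ii' Pi Pi'; apply: contrapT => /eqP nPP.
  have adjN k : P k != p None -> gadj J (p None) (P k).
    move=> Pk; have [|E|//] := adjp None (Some k); first by rewrite /= /rel_graph_adj.
    by case/eqP: Pk; rewrite /P E.
  have adjP : gadj J (P i) (P i').
    have [|E|//] := adjp (Some i) (Some i').
      by rewrite /= /rel_graph_adj /fan_rel /= ii' eqxx andbT (inj_eq Some_inj) -val_eqE /=
        ii' neq_ltn ltnSn.
    by case/eqP: nPP.
  set S : {set gV J} := [set p None; P i; P i'].
  have S0 : S != set0 by apply/set0Pn; exists (p None); rewrite !inE eqxx.
  have [v vS] := tw_degenerate twJ S0; apply/negP; rewrite -ltnNge.
  have two u u' : u != u' -> u \in S -> u' \in S -> gadj J v u -> gadj J v u' ->
      1 < #|[set u in S | gadj J v u]|.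
    move=> nuu uS u'S vu vu'; apply: leq_trans (_ : #|[set u; u']| <= _); first by rewrite cards2 nuu.
    by apply/subset_leq_card/subsetP=> z /set2P[]->; rewrite inE ?uS ?u'S.
  have [S1 S2 S3] : [/\ p None \in S, P i \in S & P i' \in S] by rewrite !inE !eqxx ?orbT.
  move: vS; rewrite !inE -orbA => /or3P[]/eqP vE.
  - by apply: (two (P i) (P i')); rewrite // vE adjN.
  - by apply: (two (p None) (P i')); rewrite 1?eq_sym // vE // gsym adjN.
  - by apply: (two (p None) (P i)); rewrite 1?eq_sym // vE gsym // adjN.
apply: (crowded (idx j) (P (idx j ord0)) (@idx_injr j)) => -[e he].
elim: e he => [|e IH] he; first by congr (P (idx _ _)); exact: val_inj.
by rewrite -(IH (ltnW he)); symmetry; apply: flat; rewrite //= addnS.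
Qed.

(** If both alternatives fail, some component is a star with three leaves and there is a vertex
    outside it, giving an induced K_{1,3} + K_1 in a fan. *)
Lemma utw1_necessary (H : sgraph) : utw_witness (I_ H) 1 ->
  is_star H \/ (forall x : gV H, path_on (component x) /\ #|component x| <= 3).
Proof.
move=> wit; have sf : star_forest H by apply: bounded_star_forest; exists 1.
have [star|nstar] := pselect (is_star H); [by left | right => x].
have [small|large] := leqP #|component x| 3; first by split=> //; exact: star_path_on (sf x) small.
have [n [f [injf adjf]]] := fan_sub wit.
have [c cx adjC] := sf x; have adjE y z := star_onE (y := y) (z := z) adjC.
have [z zx] : exists z, z \notin component x.
  apply: contrapT => /forallNP allx; case: nstar.
  have CT : component x = setT by apply/setP=> z; rewrite in_setT; apply/negbNE/negP/allx.
  by rewrite /is_star -CT; exact: sf.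
have zout y : y \in component x -> ~~ gadj H y z.
  by move=> yx; apply: contra zx => /component_adj; rewrite (component_eq yx).
have : 2 < #|component x :\ c| by have := cardsD1 c (component x); rewrite cx; lia.
case/card_gt2P=> a [b [d [[aL bL dL] [ab bd da]]]].
have leaf_in y : y \in component x :\ c -> y \in component x by case/setD1P.
have leaf_adj y : y \in component x :\ c -> gadj H c y.
  by case/setD1P=> nyc yx; rewrite adjE // eqxx (negbTE nyc).
have leaf_ind y u : y \in component x :\ c -> u \in component x :\ c -> ~~ gadj H y u.
  by move=> /setD1P[/negbTE nyc yx] /setD1P[/negbTE nuc ux]; rewrite adjE // nyc nuc.
(* The apex is adjacent to every other vertex, so a vertex with a non-neighbour lies on the path.
   This applies to the whole claw, but a path vertex has only two path neighbours. *)
have path_vertex y u : y != u -> ~~ gadj H y u -> exists i, f y = Some i.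
  move=> nyu; rewrite -adjf /= /rel_graph_adj /= (inj_eq injf) nyu /=.
  by case: (f y) => [i|]; [exists i | case: (f u)].
have [ic fc] : exists i, f c = Some i.
  by apply: (path_vertex c z); [apply: contraNneq zx => <- | exact: zout].
have [ia fa] := path_vertex a b ab (leaf_ind a b aL bL).
have [ib fb] := path_vertex b d bd (leaf_ind b d bL dL).
have [id fd] := path_vertex d a da (leaf_ind d a dL aL).
have consecutive y i : y \in component x :\ c -> f y = Some i ->
    (i : nat) = ic.+1 \/ (ic : nat) = i.+1.
  move=> /leaf_adj; rewrite -adjf fc => + fy; rewrite fy /= /rel_graph_adj /fan_rel /=.
  by case/andP=> _ /orP[]/eqP; auto.
have distinct y u i j : y != u -> f y = Some i -> f u = Some j -> (i : nat) <> j.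
  move=> nyu fy fu ij; case/eqP: nyu; apply: injf; rewrite fy fu.
  by congr Some; exact: val_inj.
have := consecutive a ia aL fa; have := consecutive b ib bL fb.
have := consecutive d id dL fd; have := distinct _ _ _ _ ab fa fb.
have := distinct _ _ _ _ bd fb fd; have := distinct _ _ _ _ da fd fa.
by move: (nat_of_ord ia) (nat_of_ord ib) (nat_of_ord id) (nat_of_ord ic); lia.
Qed.


(** * Assembling the four equivalences and bounds *)

Lemma utw_le_witness (C : gclass) (c : nat) : utw_le C c <-> utw_witness C c.
Proof.
split=> [[c' [lec wit]]|wit]; first exact: utw_witness_mono wit.
by exists c.
Qed.

Theorem theorem8p1 (H : sgraph) :
  (bounded_utw (I_ H) <-> star_forest H) /\
  (star_forest H -> utw_le (I_ H) 2) /\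
  (utw_le (I_ H) 1 <->
     is_star H \/ (forall x : gV H, path_on (component x) /\ #|component x| <= 3)) /\
  (utw_le (I_ H) 0 <-> (path_on [set: gV H] /\ #|gV H| <= 3) \/ no_edges H).
Proof.
have two : star_forest H -> utw_witness (I_ H) 2.
  move=> /star_forest_structure[c [stc _]].
  (* The order of [H] is a crude bound for both the number of components and the number of
     leaves. *)
  by apply: (@utw_witness2 H c #|gV H| #|gV H| stc) => [|x]; rewrite ?leqW // max_card.
split; first by split=> [|/two wit]; [exact: bounded_star_forest | exists 2].
split; first by move/two/utw_le_witness.
split; rewrite utw_le_witness; split.
- exact: utw1_necessary.
- case=> [star|paths].
    have [c [stc c1]] := star_structure_star star.
    by apply: (@utw_witness1_star H c 0 #|gV H| stc c1) => // x; exact: max_card.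
  have sf : star_forest H by move=> x; have [px cx] := paths x; exact: path_star_on.
  have [c [stc leaves]] := star_forest_structure sf.
  apply: (@utw_witness1_cluster H c #|gV H| 2 stc) => [|x|//]; first by rewrite leqW // max_card.
  (* A component of at most three vertices has at most two leaves besides its centre, as s = 2
     demands. *)
  have [_ small] := paths x; have [cx /subset_leq_card] := leaves x.
  by have := cardsD1 (c x) (component x); rewrite cx; lia.
- exact: utw0_necessary.
case=> [[pathH small]|noE].
  have starH : is_star H by apply: path_star_on => //; rewrite cardsT.
  have [c [stc c1]] := star_structure_star starH.
  apply: (@utw_witness0_cluster H c 0 2 stc c1) => // x.
  have : star_leaves c x \subset setT :\ c x.
    by apply/subsetP=> y; rewrite !inE => /andP[_ ->].
  move/subset_leq_card; have := cardsD1 (c x) setT; rewrite inE cardsT; lia.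
apply: (@utw_witness0_independent H id #|gV H| 0 (star_structure_independent noE)) => [|x|//].
  by rewrite leqW // max_card.
by rewrite no_edges_leaves.
Qed.
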